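(* Let $\mathfrak{e} \subset \mathbb{C}$ be a compact set that is not finite, and fix an integer $n\ge 1$. Let $t_n = \|T_n\|_{\mathfrak{e}}$, where $T_n$ is the degree $n$ Chebyshev polynomial of $\mathfrak{e}$. Then $t_n = C(\mathfrak{e})^n$ if and only if there is a polynomial $P$ of degree $n$ with $$O\partial(\mathfrak{e}) = P^{-1}(\partial\mathbb{D}) = \{z\in\mathbb{C} : |P(z)| = 1\},$$ where $O\partial(\mathfrak{e})$ is the outer boundary of $\mathfrak{e}$.
   Context: For a compact, not finite set $\mathfrak{e}\subset\mathbb{C}$ and a continuous function $f$ on $\mathfrak{e}$, $\|f\|_{\mathfrak{e}} = \sup_{z\in\mathfrak{e}}|f(z)|$. The Chebyshev polynomial $T_n$ of $\mathfrak{e}$ is the unique monic polynomial of degree $n$ minimizing $\|P\|_{\mathfrak{e}}$ over all monic polynomials $P$ of degree $n$. $C(\mathfrak{e})$ denotes the logarithmic capacity of $\mathfrak{e}$. $\mathbb{D}$ is the open unit disk. The set $\mathbb{C}\setminus\mathfrak{e}$ has exactly one unbounded component $\mathfrak{e}^\sharp$; the outer boundary $O\partial(\mathfrak{e})$ is the topological boundary of $\mathfrak{e}^\sharp$. *)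

(* Defs.v *)
From mathcomp Require Import all_boot all_order all_algebra.
From mathcomp Require Import all_classical all_reals all_analysis.
From mathcomp Require Import complex.

Set Implicit Arguments.
Unset Strict Implicit.
Unset Printing Implicit Defensive.

Import Order.TTheory GRing.Theory Num.Theory numFieldNormedType.Exports.

Local Open Scope classical_set_scope.
Local Open Scope ring_scope.

(* [R[i]] itself carries no topology in the library; packaging it as a
   [numClosedFieldType] gives it the topology of the norm [`|z|]. *)
Definition CC (R : realType) : numClosedFieldType := R[i].

(* The norm [`|z|] of [CC R] takes its values in [CC R]; this is the modulus
   with values in [R]. *)
Definition cmod (R : realType) (z : CC R) : R := Normc.normc z.

Section ChebyshevCapacity.
Variable R : realType.
Implicit Types (e A : set (CC R)).

Definition sup_norm e (f : CC R -> CC R) : R := sup [set cmod (f z) | z in e].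

(* Recall that [size P] is the degree plus one. *)
Definition is_chebyshev e (n : nat) (T : {poly CC R}) : Prop :=
  [/\ T \is monic, size T = n.+1 &
      forall P : {poly CC R}, P \is monic -> size P = n.+1 ->
        sup_norm e (horner T) <= sup_norm e (horner P)].

Definition borelCC := g_sigma_algebraType (@open (CC R)).

(* I(mu) = \iint log (1 / |z - w|) dmu(w) dmu(z). Since [lne 0 = -oo], the
   kernel is [+oo] on the diagonal. *)
Definition log_energy (mu : probability borelCC R) : \bar R :=
  (\int[mu]_z \int[mu]_w (- lne (cmod (z - w))%:E))%E.

(* The infimum of the energy over the Borel probability measures carried
   by [e]; it is [+oo] exactly when [e] is polar. *)
Definition min_energy e : \bar R :=
  ereal_inf [set log_energy mu | mu in [set mu : probability borelCC R | mu e = 1%E]].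

(* Logarithmic capacity exp (- inf I), which is 0 when the infimum is [+oo].
   For [e] compact the infimum is never [-oo], so [fine] loses nothing. *)
Definition capacity e : R := fine (expeR (- min_energy e)%E).

(* The union of the unbounded components of the complement of [e]; for [e]
   compact there is exactly one such component. *)
Definition unbounded_component e : set (CC R) :=
  [set z | ~ e z /\ ~ bounded_set (connected_component (~` e) z)].

Definition topological_boundary A : set (CC R) := closure A `\` interior A.

Definition outer_boundary e : set (CC R) :=
  topological_boundary (unbounded_component e).

End ChebyshevCapacity.

(* Main.v *)
(** Lower bound: integrating the sum of log (1 / |x_i - x_j|) over N
    independent points shows that the energy of any probability measure on [e]
    is at least the minimum of that sum over [e], and the Vandermonde
    determinant, written in the monic polynomials Q ^ (l / m) X ^ (l mod m),
    bounds the latter.  Letting N tend to infinity gives C(e)^m <= ||Q|| for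
    every monic Q of degree m.

    If the outer boundary is {|P| = 1}, then |P| <= 1 on [e], so t_n is at most
    1 / |a| with [a] the leading coefficient of [P].  The average over the
    circle of the normalised fibres of [P] is a measure on {|P| = 1} whose
    energy is at most (ln |a|) / n, because log |u - s| has nonnegative mean
    over the unit circle when |u| = 1; hence 1 / |a| <= C(e)^n <= t_n.

    Conversely, let t_n = C(e)^n.  If some point of the unbounded component
    had |T_n| <= t_n, the set E of the points of [e] with |T_n| = t_n would
    miss an arc of the lemniscate {|T_n| = t_n}.  Poles can then be pushed
    through this gap from the zeros of T_n to infinity, which yields a monic
    polynomial Q of degree kn with |Q| < t_n^k on E; then |Q T_n^m| < t_n^(k+m)
    on [e] for large m, against the lower bound.  So the unbounded component is
    {|T_n| > t_n} and its boundary is {|T_n / t_n| = 1}. *)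

From HB Require Import structures.
Require Import Defs.
From mathcomp Require Import all_boot all_order all_algebra all_fingroup.
From mathcomp Require Import all_classical all_reals all_analysis.
From mathcomp Require Import complex measurable_realfun.
From mathcomp Require Import ring lra zify.
Import Order.TTheory GRing.Theory Num.Theory numFieldNormedType.Exports.
Local Open Scope classical_set_scope.
Local Open Scope ring_scope.

Set Implicit Arguments.
Unset Strict Implicit.
Unset Printing Implicit Defensive.

(** * Complex modulus *)

(** Capacity is handled only through inequalities: an energy bound valid for every probability
    measure on [e], and one explicit measure on a lemniscate. No equilibrium measure of a general
    [e] and no Green function is constructed. Energies may be infinite and the logarithmic kernel
    changes sign. Adding a constant [c] such that [expR c] bounds the distances in [e] makes the
    kernel nonnegative there, and everything is integrated by Tonelli. The determinant is bounded
    crudely by its N! terms; ln N! is of order N ln N, negligible against the N^2 / 2 pairs. The gap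
    in the lemniscate is indispensable: on a full level set of T, the maximum principle outside it
    forbids a function finite off the level, of value 1 at infinity and small on the level. Through
    the gap, the coordinate itself becomes a uniform limit of functions finite at infinity. The mean
    of log |u - s| is singular for |u| = 1. It is estimated first for |w| > 1, where the integrand
    is continuous, and then carried to the circle by Fatou's lemma. The fibres of P become a measure
    only after their points have been chosen measurably in s. *)

Lemma horner_continuous (K : numFieldType) (p : {poly K}) :
  continuous (horner p : K -> K).
Proof.
elim/poly_ind: p => [|p c IH] z.
  by rewrite (_ : horner 0 = cst 0); [exact: cst_continuous|apply/funext => w; rewrite horner0].
rewrite (_ : horner _ = (horner p \* id) + cst c); last first.
  by apply/funext => w; rewrite hornerMXaddC.
by apply: continuousD; [apply: continuousM; [exact: IH|exact: cvg_id]|exact: cst_continuous].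
Qed.

Section Modulus.
Variable R : realType.
Implicit Types (z w : CC R) (r : R).

Definition mkC (x y : R) : CC R := Complex x y.
Definition rC (x : R) : CC R := Complex x 0.
Definition cRe (z : CC R) : R := complex.Re z.
Definition cIm (z : CC R) : R := complex.Im z.

Lemma normCC z : `|z| = rC (cmod z).
Proof. by case: z. Qed.

Lemma rC_le x y : (rC x <= rC y) = (x <= y).
Proof. exact: lecR. Qed.

Lemma rC_lt x y : (rC x < rC y) = (x < y).
Proof. exact: ltcR. Qed.

Lemma cmod_ge0 z : 0 <= cmod z.
Proof. by case: z => a b; exact: sqrtr_ge0. Qed.

Lemma cmod0 : cmod (0 : CC R) = 0.
Proof. exact: Normc.normc0. Qed.

Lemma cmod1 : cmod (1 : CC R) = 1.
Proof. exact: Normc.normc1. Qed.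

Lemma cmod_eq0 z : (cmod z == 0) = (z == 0).
Proof.
apply/eqP/eqP => [|->]; last exact: cmod0.
exact: Normc.eq0_normc.
Qed.

Lemma cmod_gt0 z : (0 < cmod z) = (z != 0).
Proof. by rewrite lt_def cmod_ge0 andbT cmod_eq0. Qed.

Lemma cmodM z w : cmod (z * w) = cmod z * cmod w.
Proof. exact: Normc.normcM. Qed.

Lemma cmodV z : cmod z^-1 = (cmod z)^-1.
Proof. exact: Normc.normcV. Qed.

Lemma cmodN z : cmod (- z) = cmod z.
Proof. exact: normcN. Qed.

Lemma cmod_distC z w : cmod (z - w) = cmod (w - z).
Proof. by rewrite -cmodN opprB. Qed.

Lemma cmodD z w : cmod (z + w) <= cmod z + cmod w.
Proof. exact: le_normcD. Qed.

Lemma cmodB_ge z w : cmod z - cmod w <= cmod (z - w).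
Proof. by rewrite lerBlDr (le_trans _ (cmodD _ _)) // subrK. Qed.

Lemma cmodX z n : cmod (z ^+ n) = cmod z ^+ n.
Proof.
by elim: n => [|n IH]; rewrite ?expr0 ?cmod1 // !exprS cmodM IH.
Qed.

Lemma cmod_rC r : cmod (rC r) = `|r|.
Proof. by rewrite /cmod /= expr0n /= addr0 sqrtr_sqr. Qed.

Lemma rCD r s : rC (r + s) = rC r + rC s.
Proof. exact: (rmorphD (real_complex R)). Qed.

Lemma rCM r s : rC (r * s) = rC r * rC s.
Proof. exact: (rmorphM (real_complex R)). Qed.

Lemma rC1 : rC 1 = 1. Proof. by []. Qed.

Lemma cmod_sum (I : Type) (s : seq I) (P : pred I) (F : I -> CC R) :
  cmod (\sum_(i <- s | P i) F i) <= \sum_(i <- s | P i) cmod (F i).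
Proof.
elim/big_rec2: _ => [|i y x _ le_xy]; first by rewrite cmod0.
by rewrite (le_trans (cmodD _ _)) // lerD2l.
Qed.

Lemma cmod_prod (I : Type) (s : seq I) (P : pred I) (F : I -> CC R) :
  cmod (\prod_(i <- s | P i) F i) = \prod_(i <- s | P i) cmod (F i).
Proof.
elim/big_rec2: _ => [|i y x _ <-]; first by rewrite cmod1.
by rewrite cmodM.
Qed.

Lemma Re_le_cmod z : `|cRe z| <= cmod z.
Proof.
case: z => a b /=; rewrite /cmod /= -[leLHS]sqrtr_sqr ler_wsqrtr //.
by rewrite lerDl sqr_ge0.
Qed.

Lemma Im_le_cmod z : `|cIm z| <= cmod z.
Proof.
case: z => a b /=; rewrite /cmod /= -[leLHS]sqrtr_sqr ler_wsqrtr //.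
by rewrite lerDr sqr_ge0.
Qed.

Lemma cmod_leD z : cmod z <= `|cRe z| + `|cIm z|.
Proof.
case: z => a b /=; rewrite /cmod /=.
rewrite -[leRHS]ger0_norm ?addr_ge0 // -sqrtr_sqr ler_wsqrtr //.
rewrite sqrrD !real_normK ?num_real //.
by rewrite lerD2r lerDl mulrn_wge0 // mulr_ge0.
Qed.

Lemma cReD z w : cRe (z + w) = cRe z + cRe w. Proof. by case: z; case: w. Qed.
Lemma cReB z w : cRe (z - w) = cRe z - cRe w. Proof. by case: z; case: w. Qed.
Lemma cImD z w : cIm (z + w) = cIm z + cIm w. Proof. by case: z; case: w. Qed.
Lemma cImB z w : cIm (z - w) = cIm z - cIm w. Proof. by case: z; case: w. Qed.
Lemma cReM z w : cRe (z * w) = cRe z * cRe w - cIm z * cIm w.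
Proof. by case: z; case: w. Qed.
Lemma cImM z w : cIm (z * w) = cRe z * cIm w + cIm z * cRe w.
Proof. by case: z; case: w. Qed.

Lemma ballCC z r w : ball z (rC r) w <-> cmod (w - z) < r.
Proof. by rewrite /ball /= distrC normCC rC_lt. Qed.

Lemma posCC (x : CC R) : 0 < x -> exists2 r, 0 < r & x = rC r.
Proof.
case: x => a b; rewrite ltcE /= => /andP[/eqP -> a0].
by exists a.
Qed.

(** Radii of balls are elements of [CC R]; the positive ones are real, so real radii suffice to test
    neighbourhoods. *)
Lemma nbhsCC z (A : set (CC R)) :
  nbhs z A <-> exists2 r, 0 < r & forall w, cmod (w - z) < r -> A w.
Proof.
rewrite -nbhs_ballE; split.
  move=> [x /= /posCC[r r0 ->]] sub; exists r => // w wr.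
  by apply: sub; apply/ballCC.
move=> [r r0 sub]; exists (rC r); first by rewrite /= (rC_lt 0).
by move=> w /ballCC; exact: sub.
Qed.

Lemma openCC (A : set (CC R)) : open A <->
  forall z, A z -> exists2 r, 0 < r & forall w, cmod (w - z) < r -> A w.
Proof.
rewrite openE; split=> H z Az.
  by apply/nbhsCC/H.
by apply/nbhsCC/H.
Qed.

Lemma closureCC (A : set (CC R)) z : closure A z <->
  forall r, 0 < r -> exists2 w, A w & cmod (w - z) < r.
Proof.
split=> [cl r r0|H B /nbhsCC[r r0 sub]].
  have /cl[w [Aw /= wB]] : nbhs z [set w | cmod (w - z) < r].
    by apply/nbhsCC; exists r.
  by exists w.
by have [w Aw /sub] := H _ r0; exists w.
Qed.

Lemma continuous_cmod_fun (f : CC R -> CC R) z : {for z, continuous f} ->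
  forall e : R, 0 < e ->
    exists2 r, 0 < r & forall w, cmod (w - z) < r -> cmod (f w - f z) < e.
Proof.
move=> cf e e0; apply/nbhsCC.
have /cf : nbhs (f z) [set w | cmod (w - f z) < e] by apply/nbhsCC; exists e.
by [].
Qed.

Lemma horner_cont (p : {poly CC R}) : continuous (horner p).
Proof. exact: horner_continuous. Qed.

Lemma cmod_continuous : continuous (@cmod R).
Proof.
move=> z A /nbhs_ballP[e e0 sub]; apply/nbhsCC; exists e => // w wz.
apply: sub; rewrite /ball /= (le_lt_trans _ wz) // ler_norml lerNl opprB cmodB_ge.
by rewrite cmod_distC cmodB_ge.
Qed.

Lemma cmod_horner_cont (p : {poly CC R}) :
  continuous (fun z : CC R => cmod p.[z]).
Proof.
move=> z; apply: (@continuous_comp _ _ _ (horner p) (@cmod R)).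
  exact: horner_cont.
exact: cmod_continuous.
Qed.

End Modulus.

(** * Compactness, components and the maximum principle *)

Section Plane.
Variable R : realType.
Implicit Types (z w : CC R) (r : R).

Lemma compact_modulus_max (A : set (CC R)) (p : {poly CC R}) :
  compact A -> A !=set0 ->
  exists2 z, A z & forall w, A w -> cmod p.[w] <= cmod p.[z].
Proof.
move=> cA A0.
have [|z /set_mem Az zM] := @compact_EVT_max _ R (fun z => cmod p.[z]) A A0 cA.
  by apply: continuous_subspaceT; exact: cmod_horner_cont.
by exists z => // w /mem_set; exact: zM.
Qed.

Lemma compact_bound (A : set (CC R)) (p : {poly CC R}) : compact A ->
  exists2 M, 0 < M & forall z, A z -> cmod p.[z] <= M.
Proof.
move=> cA; have [->|/set0P A0] := eqVneq A set0; first by exists 1.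
have [z Az zM] := @compact_modulus_max A p cA A0.
exists (cmod p.[z] + 1); first by rewrite ltr_wpDl ?cmod_ge0.
by move=> w /zM wz; rewrite (le_trans wz) // lerDl.
Qed.

Lemma compact_closedCC (A : set (CC R)) : compact A -> closed A.
Proof. by apply: compact_closed; exact: (@norm_hausdorff _ (CC R)). Qed.

Lemma bounded_setCC (A : set (CC R)) :
  bounded_set A <-> exists M : R, forall z, A z -> cmod z <= M.
Proof.
split=> [[x [xr xA]]|[M MA]].
  have [r xE] : exists r : R, x = rC r.
    by case: x xr {xA} => a b; rewrite complex_real => /eqP ->; exists a.
  exists (r + 1) => z Az.
  have := xA (rC (r + 1)); rewrite xE rC_lt ltrDl ltr01 => /(_ isT z Az) zr.
  by have : `|z| <= rC (r + 1) := zr; rewrite normCC rC_le.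
exists (rC M); split; first by rewrite /rC complex_real.
move=> x xM z Az; suff : `|z| <= x by []; rewrite normCC (le_trans _ (ltW xM)) // rC_le; exact: MA.
Qed.

Lemma mkC_cont : continuous (fun x : R * R => mkC x.1 x.2).
Proof.
move=> [x y] /= A /nbhsCC[r r0 sub].
exists (ball x (r / 2), ball y (r / 2)) => /=.
  by split; apply: nbhsx_ballx; rewrite divr_gt0.
move=> [u v] /= [ux vy]; apply: sub.
rewrite (le_lt_trans (cmod_leD _)) // cReB cImB /= (splitr r) ltrD //.
  by rewrite distrC.
by rewrite distrC.
Qed.

Lemma closed_disk_compact (M : R) : compact [set z : CC R | cmod z <= M].
Proof.
apply: (@subclosed_compact _ _ ((fun x : R * R => mkC x.1 x.2) @`
    (`[- M, M]%classic `*` `[- M, M]%classic))).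
- rewrite (_ : mkset _ = (@cmod R) @^-1` [set x : R | x <= M]) //.
  apply: closed_comp => [z _|]; first exact: cmod_continuous.
  exact: closed_le.
- apply: continuous_compact.
    by apply: continuous_subspaceT; exact: mkC_cont.
  by apply: compact_setX; exact: segment_compact.
- move=> z /= zM; exists (cRe z, cIm z); last by case: z {zM}.
  split => /=; rewrite in_itv /= -ler_norml.
    exact: le_trans (Re_le_cmod z) zM.
  exact: le_trans (Im_le_cmod z) zM.
Qed.

Lemma closed_bounded_compactCC (A : set (CC R)) (M : R) :
  closed A -> (forall z, A z -> cmod z <= M) -> compact A.
Proof.
move=> clA AM; apply: (subclosed_compact clA (@closed_disk_compact M)) => z.
exact: AM.
Qed.

Lemma segmentCC_connected z w :
  connected ((fun t : R => z + rC t * (w - z)) @` `[0, 1]%classic).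
Proof.
apply: connected_continuous_connected; first exact: segment_connected.
apply: continuous_subspaceT => t A /nbhsCC[r r0 sub].
have d0 : 0 < cmod (w - z) + 1 by rewrite ltr_wpDl ?cmod_ge0.
apply/nbhs_ballP; exists (r / (cmod (w - z) + 1)); first by rewrite /= divr_gt0.
move=> s; rewrite /ball /= ltr_pdivlMr // => ts; apply: sub.
rewrite opprD addrACA subrr add0r -mulrBl (_ : rC s - rC t = rC (s - t)); last first.
  by rewrite /rC; congr Complex; rewrite subr0.
rewrite cmodM cmod_rC distrC (le_lt_trans _ ts) // ler_wpM2l //.
by rewrite lerDl.
Qed.

(** The segment from [w] to [w'] is a connected subset of the disc, hence of [A]. *)
Lemma ball_in_component (A : set (CC R)) z w w' r :
  connected_component A z w -> (forall u, cmod (u - w) < r -> A u) ->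
  cmod (w' - w) < r -> connected_component A z w'.
Proof.
move=> zw sub w'r; apply: connected_component_trans zw _.
apply: (@connected_component_max _ _
  ((fun t : R => w + rC t * (w' - w)) @` `[0, 1]%classic)).
- exists 0; first by rewrite /= in_itv /= lexx ler01.
  by rewrite mul0r addr0.
- move=> _ [t + <-]; rewrite /= in_itv /= => /andP[t0 t1]; apply: sub.
  rewrite addrC addKr cmodM cmod_rC ger0_norm // (le_lt_trans _ w'r) //.
  by rewrite ler_piMl ?cmod_ge0.
- exact: segmentCC_connected.
- exists 1; first by rewrite /= in_itv /= lexx ler01.
  by rewrite mul1r addrC subrK.
Qed.

Lemma connected_clopen_sub (A G : set (CC R)) z : connected A -> A z -> G z ->
  open G -> A `&` closure G `<=` G -> A `<=` G.
Proof.
move=> cA Az Gz oG clG.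
rewrite -(cA (A `&` G)); first by move=> x [].
- by exists z.
- by exists G.
- exists (closure G); first exact: closed_closure.
  rewrite eqEsubset; split=> x [Ax Gx]; split=> //; first exact: subset_closure.
  exact: clG.
Qed.

Lemma open_gt_modulus (p : {poly CC R}) (t : R) :
  open [set z : CC R | t < cmod p.[z]].
Proof.
rewrite (_ : mkset _ = (fun z => cmod p.[z]) @^-1` [set x : R | t < x]) //.
apply: open_comp => [z _|]; first exact: cmod_horner_cont.
exact: open_gt.
Qed.

Lemma open_lt_modulus (p : {poly CC R}) (t : R) :
  open [set z : CC R | cmod p.[z] < t].
Proof.
rewrite (_ : mkset _ = (fun z => cmod p.[z]) @^-1` [set x : R | x < t]) //.
apply: open_comp => [z _|]; first exact: cmod_horner_cont.
exact: open_lt.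
Qed.

Lemma local_expansion (p : {poly CC R}) z : (1 < size p)%N ->
  exists m (g : {poly CC R}), [/\ (0 < m)%N, g.[z] != 0 &
    forall w, p.[w] = p.[z] + g.[w] * (w - z) ^+ m].
Proof.
move=> p1; have [m [g ng pE]] := multiplicity_XsubC (p - p.[z]%:P) z.
have pN0 : p - p.[z]%:P != 0.
  apply: contraTneq p1 => /eqP; rewrite subr_eq0 => /eqP ->.
  by rewrite -leqNgt size_polyC_leq1.
move: ng; rewrite pN0 /= => gz.
exists m, g; split; last 2 first.
- exact: gz.
- move=> w; have := congr1 (horner^~ w) pE; rewrite !hornerE /= => <-.
  by rewrite addrC subrK.
case: m pE => // pE; have := congr1 (horner^~ z) pE.
rewrite expr0 mulr1 !hornerE subrr => /esym/eqP; rewrite -rootE => gz0.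
by rewrite gz0 in gz.
Qed.

Lemma rootCC (c : CC R) m : (0 < m)%N -> exists u : CC R, u ^+ m = c.
Proof.
move=> m0; have [u] := @solve_monicpoly (CC R) m (fun i => if i == 0%N then c else 0) m0.
case: m m0 => // m _; rewrite big_ord_recl /= expr0 mulr1 big1 ?addr0; last first.
  by move=> i _; rewrite mul0r.
by exists u.
Qed.

(* Moving from [z] in a direction [u] with [u ^+ m = c p(z) / g(z)] changes
   [p] by a factor close to [1 + c tau ^+ m]. *)
Lemma local_scaling (p : {poly CC R}) z (c : R) : (1 < size p)%N ->
  p.[z] != 0 -> `|c| = 1 -> forall r, 0 < r ->
  exists w tau, [/\ cmod (w - z) < r, 0 < tau, tau <= 1 &
    cmod (p.[w] / p.[z] - rC (1 + c * tau)) <= tau / 2].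
Proof.
move=> p1 pz0 c1 r r0; have [m [g [m0 gz pE]]] := @local_expansion p z p1.
have [u uE] := @rootCC (rC c * p.[z] / g.[z]) m m0.
have gz0 : 0 < cmod g.[z] by rewrite cmod_gt0.
have [|d d0 gd] := @continuous_cmod_fun _ (horner g) z (@horner_cont _ g z) (cmod g.[z] / 2).
  by rewrite divr_gt0.
(* [s <= 1] gives [tau <= 1]; [s * cmod u < d] keeps the new point where [g] deviates from [g.[z]]
   by less than half of [cmod g.[z]], the source of the error [tau / 2]. *)
pose s := Num.min 1 (Num.min r d / (cmod u + 1) / 2).
have u1 : 0 < cmod u + 1 by rewrite ltr_wpDl ?cmod_ge0.
have s0 : 0 < s by rewrite lt_min ltr01 !divr_gt0 // lt_min r0.
have s1 : s <= 1 by rewrite ge_min lexx.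
have su : s * cmod u < Num.min r d.
  have : s <= Num.min r d / (cmod u + 1) / 2 by rewrite ge_min lexx orbT.
  have md : 0 < Num.min r d by rewrite lt_min r0.
  rewrite -mulrA -invfM ler_pdivlMr ?mulr_gt0 // => sm.
  have := cmod_ge0 u; nra.
have zw : cmod (rC s * u) < Num.min r d by rewrite cmodM cmod_rC gtr0_norm.
exists (z + rC s * u), (s ^+ m).
have wz : z + rC s * u - z = rC s * u by rewrite addrC addKr.
move: zw; rewrite lt_min => /andP[zr zd].
split; rewrite ?wz //; first exact: exprn_gt0.
  by rewrite exprn_ile1 // ltW.
rewrite pE wz exprMn uE mulrDl divff //.
have rX k : rC s ^+ k = rC (s ^+ k).
  by elim: k => // k IH; rewrite !exprS IH rCM.
set gw := g.[_]; rewrite rX rCD rCM rC1 opprD addrACA subrr add0r.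
have -> : gw * (rC (s ^+ m) * (rC c * p.[z] / g.[z])) / p.[z] - rC c * rC (s ^+ m)
   = rC c * rC (s ^+ m) * ((gw - g.[z]) / g.[z]).
  by field; rewrite gz.
rewrite !cmodM !cmod_rC c1 mul1r gtr0_norm ?exprn_gt0 // cmodV.
rewrite ler_wpM2l ?exprn_ge0 ?(ltW s0) // ler_pdivrMr // mulrC.
by apply: ltW; apply: gd; rewrite wz.
Qed.

(** Local form of the maximum principle. Where [p] does not vanish, [c = 1] multiplies it by nearly
    [1 + tau], and the error [tau / 2] leaves a factor above 1. Zeros go through [local_expansion],
    since [local_scaling] divides by [p.[z]]. *)
Lemma modulus_increase (p : {poly CC R}) z r : (1 < size p)%N -> 0 < r ->
  exists2 w, cmod (w - z) < r & cmod p.[z] < cmod p.[w].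
Proof.
move=> p1 r0; have [pz0|pz0] := eqVneq p.[z] 0.
  have [m [g [m0 gz pE]]] := @local_expansion p z p1.
  have gz0 : 0 < cmod g.[z] by rewrite cmod_gt0.
  have [d d0 gd] := @continuous_cmod_fun _ (horner g) z (@horner_cont _ g z) (cmod g.[z]) gz0.
  have md : 0 < Num.min r d by rewrite lt_min r0.
  have h : cmod (rC (Num.min r d / 2)) < Num.min r d.
    rewrite cmod_rC gtr0_norm ?divr_gt0 //; lra.
  have := h; rewrite lt_min => /andP[hr hd].
  have wz : z + rC (Num.min r d / 2) - z = rC (Num.min r d / 2) by rewrite addrC addKr.
  exists (z + rC (Num.min r d / 2)); first by rewrite wz.
  rewrite pz0 cmod0 pE pz0 add0r cmodM wz cmodX mulr_gt0 //.
    have /gd/(le_lt_trans _) : cmod (z + rC (Num.min r d / 2) - z) < d by rewrite wz.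
    rewrite cmod_distC => /(_ _ (cmodB_ge _ _)); lra.
  by rewrite exprn_gt0 // cmod_rC gtr0_norm divr_gt0.
have [|w [tau [wz t0 t1 H]]] := @local_scaling p z 1 p1 pz0 _ r r0.
  by rewrite normr1.
exists w => //; have pz : 0 < cmod p.[z] by rewrite cmod_gt0.
suff : 1 < cmod (p.[w] / p.[z]) by rewrite cmodM cmodV ltr_pdivlMr // mul1r.
have := cmodB_ge (rC (1 + 1 * tau)) (rC (1 + 1 * tau) - p.[w] / p.[z]).
rewrite subKr cmod_distC cmod_rC ger0_norm; last by lra.
lra.
Qed.

Lemma modulus_decrease (p : {poly CC R}) z r : (1 < size p)%N -> p.[z] != 0 ->
  0 < r -> exists2 w, cmod (w - z) < r & cmod p.[w] < cmod p.[z].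
Proof.
move=> p1 pz0 r0.
have [|w [tau [wz t0 t1 H]]] := @local_scaling p z (-1) p1 pz0 _ r r0.
  by rewrite normrN1.
exists w => //; have pz : 0 < cmod p.[z] by rewrite cmod_gt0.
suff : cmod (p.[w] / p.[z]) < 1 by rewrite cmodM cmodV ltr_pdivrMr // mul1r.
have := cmodD (p.[w] / p.[z] - rC (1 + -1 * tau)) (rC (1 + -1 * tau)).
rewrite subrK cmod_rC ger0_norm; last by lra.
lra.
Qed.

(** On the compact closure of a bounded component, [p] would attain its maximal modulus at a point
    still above level [t]. A whole disc around that point then lies in the component, and
    [modulus_increase] finds a larger value in it. *)
Lemma superlevel_component_unbounded (p : {poly CC R}) (t : R) z :
  (1 < size p)%N -> t < cmod p.[z] ->
  forall M : R, exists2 w, connected_component [set u | t < cmod p.[u]] z w &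
    M < cmod w.
Proof.
move=> p1 pz M; apply: contrapT => H.
pose W := connected_component [set u : CC R | t < cmod p.[u]] z.
have WM w : W w -> cmod w <= M.
  by move=> Ww; rewrite leNgt; apply/negP => Mw; apply: H; exists w.
have Wz : W z by exact: connected_component_refl.
have cW : compact (closure W).
  apply: (@closed_bounded_compactCC _ (M + 1)); first exact: closed_closure.
  move=> w /closureCC/(_ 1 ltr01)[w' /WM w'M ww'].
  have := cmodB_ge w w'; rewrite cmod_distC; lra.
have [|w clw wM] := @compact_modulus_max _ p cW; first by exists z; exact: subset_closure.
have pw : t < cmod p.[w].
  by apply: lt_le_trans pz _; apply: wM; exact: subset_closure.
have [r r0 sub] := (openCC _).1 (@open_gt_modulus p t) w pw.
have [w1 w1r w1p] := @modulus_increase p w r p1 r0.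
have Ww : W w1.
  have [w2 Ww2 w2r] := (closureCC _ _).1 clw r r0.
  have w2w : connected_component [set u | t < cmod p.[u]] w w2.
    apply: ball_in_component sub w2r; exact: connected_component_refl.
  have ww1 : connected_component [set u | t < cmod p.[u]] w w1.
    apply: ball_in_component sub w1r; exact: connected_component_refl.
  apply: connected_component_trans Ww2 _.
  by apply: connected_component_trans ww1; exact: connected_component_sym.
by have := wM _ (subset_closure Ww); rewrite leNgt w1p.
Qed.

End Plane.

(** * Uniform approximation by rational functions with poles at the zeros of T *)

Section Approx.
Variable R : realType.
Implicit Types (z w : CC R) (r : R) (e : set (CC R)).

Lemma sup_norm_ub e (p : {poly CC R}) z : compact e -> e z ->
  cmod p.[z] <= sup_norm e (horner p).
Proof.
move=> ce ez; have [M _ HM] := compact_bound p ce.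
apply: ub_le_sup; last by exists z.
by exists M => _ [w ew <-]; exact: HM.
Qed.

Lemma sup_norm_le e (p : {poly CC R}) M : e !=set0 ->
  (forall z, e z -> cmod p.[z] <= M) -> sup_norm e (horner p) <= M.
Proof.
move=> [z ez] HM; apply: ge_sup; first by exists (cmod p.[z]), z.
by move=> _ [w ew <-]; exact: HM.
Qed.

Lemma sup_norm_lt e (p : {poly CC R}) M : compact e -> e !=set0 ->
  (forall z, e z -> cmod p.[z] < M) -> sup_norm e (horner p) < M.
Proof.
move=> ce e0 HM; have [z ez zM] := compact_modulus_max p ce e0.
exact: le_lt_trans (sup_norm_le e0 zM) (HM z ez).
Qed.

Lemma exprn_small (q eps : R) : 0 <= q -> q < 1 -> 0 < eps ->
  exists m, q ^+ m < eps.
Proof.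
move=> q0 q1 eps0; have := @cvg_expr R q.
rewrite ger0_norm // => /(_ q1)/cvgrPdist_lt/(_ _ eps0)[m _ /(_ m)] /=.
rewrite leqnn sub0r normrN ger0_norm ?exprn_ge0 // => /(_ isT) ?.
by exists m.
Qed.

Lemma poly_coercive (p : {poly CC R}) (t : R) : (1 < size p)%N ->
  exists2 M : R, 0 < M & forall z, M < cmod z -> t < cmod p.[z].
Proof.
elim/poly_ind: p t => [|p c IH] t; first by rewrite size_poly0.
move=> s1; have [p1|p1] := ltnP 1 (size p).
  have [M M0 HM] := IH (`|t| + cmod c) p1.
  exists (M + 1) => [|z zM]; first by rewrite ltr_wpDr.
  rewrite hornerMXaddC.
  have := cmodB_ge (p.[z] * z) (- c); rewrite opprK cmodN cmodM.
  have /HM : M < cmod z by lra.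
  have := ler_norm t; have := cmod_ge0 c; have := normr_ge0 t; nra.
have [a pE] : exists a, p = a%:P by exists p`_0; exact: size1_polyC.
have [a0|a0] := eqVneq a 0.
  move: s1; rewrite pE a0 mul0r add0r size_polyC; by case: (c != 0).
have ca : 0 < cmod a by rewrite cmod_gt0.
exists ((`|t| + cmod c) / cmod a + 1) => [|z].
  by rewrite ltr_wpDl // divr_ge0 ?addr_ge0 ?cmod_ge0.
rewrite -ltrBrDr => zM.
rewrite hornerMXaddC pE hornerC.
have := cmodB_ge (a * z) (- c); rewrite opprK cmodN cmodM.
have : (`|t| + cmod c) / cmod a < cmod z by lra.
rewrite ltr_pdivrMr // => H1.
have := ler_norm t; nra.
Qed.

Lemma size_polyM_leqS (p q : {poly CC R}) a b : (size p <= a.+1)%N ->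
  (size q <= b.+1)%N -> (size (p * q)%R <= (a + b).+1)%N.
Proof. by move=> pa qb; rewrite (leq_trans (size_polyMleq _ _)) //; lia. Qed.

Section Algebra.
Variables (T : {poly CC R}) (n : nat) (E : set (CC R)) (t : R).
Hypotheses (Tmonic : T \is monic) (Tsize : size T = n.+1) (t0 : 0 < t)
  (cE : compact E) (ET : forall z, E z -> cmod T.[z] = t).

(* Uniform limits on [E] of the rational functions [S / T ^+ k] that are
   finite at infinity. *)
Definition approximable (h : CC R -> CC R) : Prop :=
  forall eps : R, 0 < eps -> exists k (S : {poly CC R}),
    (size S <= (k * n).+1)%N /\
    forall z, E z -> cmod (h z - S.[z] / T.[z] ^+ k) <= eps.

Lemma sizeTX k : size (T ^+ k) = (k * n).+1.
Proof.
rewrite -[LHS]prednK ?size_exp ?Tsize 1?mulnC //.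
by rewrite size_poly_gt0 expf_neq0 // monic_neq0.
Qed.

Lemma T_neq0 z : E z -> T.[z] != 0.
Proof. by move=> /ET Tz; rewrite -cmod_gt0 Tz. Qed.

Lemma approximable_ext h1 h2 : (forall z, E z -> h1 z = h2 z) ->
  approximable h1 -> approximable h2.
Proof.
move=> h12 H eps /H[k [S [sS HS]]]; exists k, S; split=> // z Ez.
by rewrite -h12 // HS.
Qed.

Lemma approximable_rat k (S : {poly CC R}) : (size S <= (k * n).+1)%N ->
  approximable (fun z => S.[z] / T.[z] ^+ k).
Proof.
move=> sS eps eps0; exists k, S; split=> // z Ez.
by rewrite subrr cmod0 ltW.
Qed.

Lemma approximable_cst c : approximable (fun=> c).
Proof.
apply: (@approximable_ext (fun z => c%:P.[z] / T.[z] ^+ 0)).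
  by move=> z _; rewrite hornerC expr0 divr1.
by apply: approximable_rat; rewrite mul0n size_polyC_leq1.
Qed.

Lemma approximable_add h1 h2 : approximable h1 -> approximable h2 ->
  approximable (fun z => h1 z + h2 z).
Proof.
move=> H1 H2 eps eps0; have e2 : 0 < eps / 2 by rewrite divr_gt0.
have [k1 [S1 [sS1 HS1]]] := H1 _ e2; have [k2 [S2 [sS2 HS2]]] := H2 _ e2.
exists (k1 + k2)%N, (S1 * T ^+ k2 + S2 * T ^+ k1); split.
  rewrite (leq_trans (size_polyD _ _)) // geq_max.
  rewrite mulnDl size_polyM_leqS ?sizeTX //=.
  by rewrite addnC size_polyM_leqS ?sizeTX.
move=> z Ez; have Tz := T_neq0 Ez.
rewrite hornerD !hornerM !horner_exp exprD.
have -> : h1 z + h2 z - (S1.[z] * T.[z] ^+ k2 + S2.[z] * T.[z] ^+ k1)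
    / (T.[z] ^+ k1 * T.[z] ^+ k2) =
  (h1 z - S1.[z] / T.[z] ^+ k1) + (h2 z - S2.[z] / T.[z] ^+ k2).
  by field; rewrite !expf_neq0.
by rewrite (le_trans (cmodD _ _)) // (splitr eps) lerD ?HS1 ?HS2.
Qed.

Lemma approximable_bounded h : approximable h ->
  exists2 M, 0 < M & forall z, E z -> cmod (h z) <= M.
Proof.
move=> /(_ 1 ltr01)[k [S [_ HS]]]; have [M M0 HM] := compact_bound S cE.
exists (M / t ^+ k + 1) => [|z Ez]; first by rewrite addr_gt0 ?divr_gt0 ?exprn_gt0.
rewrite -[h z](subrK (S.[z] / T.[z] ^+ k)) addrC (le_trans (cmodD _ _)) // lerD ?HS //.
by rewrite cmodM cmodV cmodX ET // ler_wpM2r ?HM // invr_ge0 exprn_ge0 ?ltW.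
Qed.

Lemma approximable_mul h1 h2 : approximable h1 -> approximable h2 ->
  approximable (fun z => h1 z * h2 z).
Proof.
move=> H1 H2 eps eps0.
have [M1 M10 HM1] := approximable_bounded H1.
have [M2 M20 HM2] := approximable_bounded H2.
(* The three error terms below sum to at most [d * (M1 + M2 + d)], and [d <= 1]. *)
pose d := Num.min 1 (eps / (M1 + M2 + 1)).
have d0 : 0 < d by rewrite lt_min ltr01 divr_gt0 // !addr_gt0.
have [k1 [S1 [sS1 HS1]]] := H1 _ d0; have [k2 [S2 [sS2 HS2]]] := H2 _ d0.
exists (k1 + k2)%N, (S1 * S2); split.
  by rewrite mulnDl size_polyM_leqS.
move=> z Ez; have Tz := T_neq0 Ez.
rewrite hornerM exprD.
have := HS1 z Ez; have := HS2 z Ez.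
have -> : S1.[z] * S2.[z] / (T.[z] ^+ k1 * T.[z] ^+ k2) =
  (S1.[z] / T.[z] ^+ k1) * (S2.[z] / T.[z] ^+ k2).
  by field; rewrite !expf_neq0.
set u1 := S1.[z] / _; set u2 := S2.[z] / _ => h2u h1u.
have -> : h1 z * h2 z - u1 * u2 = h1 z * (h2 z - u2) + (h1 z - u1) * h2 z
  - (h1 z - u1) * (h2 z - u2) by ring.
rewrite (le_trans (cmodD _ _)) // cmodN.
have := cmodD (h1 z * (h2 z - u2)) ((h1 z - u1) * h2 z).
rewrite !cmodM => H.
have dle : d * (M1 + M2 + 1) <= eps.
  by rewrite -ler_pdivlMr ?ge_min ?lexx ?orbT // !addr_gt0.
have d1 : d <= 1 by rewrite ge_min lexx.
have h1M := HM1 z Ez; have h2M := HM2 z Ez.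
have a1 : cmod (h1 z) * cmod (h2 z - u2) <= M1 * d by rewrite ler_pM ?cmod_ge0.
have a2 : cmod (h1 z - u1) * cmod (h2 z) <= d * M2 by rewrite ler_pM ?cmod_ge0.
have a3 : cmod (h1 z - u1) * cmod (h2 z - u2) <= d * 1.
  by rewrite ler_pM ?cmod_ge0 // (le_trans h2u).
lra.
Qed.

Lemma approximable_exp h k : approximable h -> approximable (fun z => h z ^+ k).
Proof.
move=> H; elim: k => [|k IH]; first exact: approximable_cst.
apply: (@approximable_ext (fun z => h z * h z ^+ k)); first by move=> z _; rewrite exprS.
exact: approximable_mul.
Qed.

Lemma approximable_lim h : (forall eps : R, 0 < eps -> exists2 g,
    approximable g & forall z, E z -> cmod (h z - g z) <= eps) -> approximable h.
Proof.
move=> H eps eps0; have e2 : 0 < eps / 2 by rewrite divr_gt0.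
have [g /(_ _ e2)[k [S [sS HS]]] hg] := H _ e2.
exists k, S; split=> // z Ez.
rewrite -[h z](subrK (g z)) -addrA (le_trans (cmodD _ _)) //.
by rewrite (splitr eps) lerD ?hg ?HS.
Qed.

(** The geometric series converges uniformly on [E]: the remainder after [m] terms is
    [u ^+ m / (1 - u)], at most [q ^+ m / (1 - q)]. Every creation or displacement of a pole below
    is an instance. *)
Lemma approximable_neumann u q : q < 1 -> approximable u ->
  (forall z, E z -> cmod (u z) <= q) -> approximable (fun z => (1 - u z)^-1).
Proof.
(* A point of [E] is what forces [q] to be nonnegative; the empty set is set aside. *)
move=> q1 Hu uq; have [E0|/set0P[a Ea]] := eqVneq E set0.
  by apply: (@approximable_ext (fun=> 0)); [move=> z; rewrite E0|exact: approximable_cst].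
have q0 : 0 <= q := le_trans (cmod_ge0 _) (uq a Ea).
have sum_appr m : approximable (fun z => \sum_(i < m) u z ^+ i).
  elim: m => [|m IH].
    apply: (@approximable_ext (fun=> 0)); last exact: approximable_cst.
    by move=> z _; rewrite big_ord0.
  apply: (@approximable_ext (fun z => (\sum_(i < m) u z ^+ i) + u z ^+ m)).
    by move=> z _; rewrite big_ord_recr.
  by apply: approximable_add => //; exact: approximable_exp.
apply: approximable_lim => eps eps0.
have [|m qm] := @exprn_small q (eps * (1 - q)) q0 q1.
  by rewrite mulr_gt0 // subr_gt0.
exists (fun z => \sum_(i < m) u z ^+ i) => // z Ez.
have uz := uq z Ez.
have n1u : 1 - q <= cmod (1 - u z).
  by rewrite (le_trans _ (cmodB_ge _ _)) // cmod1 lerD2l lerN2.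
have u1 : 1 - u z != 0 by rewrite -cmod_gt0 (lt_le_trans _ n1u) // subr_gt0.
have -> : (1 - u z)^-1 - \sum_(i < m) u z ^+ i = u z ^+ m / (1 - u z).
  apply: (mulIf u1); rewrite mulrBl mulVf // divfK // mulrC.
  move: (subrX1 (u z) m); set s := \sum_(i < m) _ => us.
  have -> : (1 - u z) * s = - ((u z - 1) * s) by ring.
  by rewrite -us opprB subKr.
rewrite cmodM cmodV cmodX ler_pdivrMr ?cmod_gt0 //.
rewrite (le_trans _ (_ : eps * (1 - q) <= _)) ?ler_wpM2l ?(ltW eps0) //.
by rewrite (le_trans _ (ltW qm)) // lerXn2r // ?nnegrE ?cmod_ge0.
Qed.

End Algebra.
End Approx.

(** * Pushing poles from the zeros of T to infinity *)

Section Poles.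
Variable R : realType.
Implicit Types (z w b : CC R) (r : R) (e : set (CC R)).

Section Algebra.
Variables (T : {poly CC R}) (n : nat) (E : set (CC R)) (t : R).
Hypotheses (Tmonic : T \is monic) (Tsize : size T = n.+1) (t0 : 0 < t)
  (cE : compact E) (ET : forall z, E z -> cmod T.[z] = t).

Local Notation appr := (approximable T n E).

Lemma pole_quotient b : exists2 D : {poly CC R}, (size D <= n)%N &
  forall z, T.[z] - T.[b] = D.[z] * (z - b).
Proof.
have /factor_theorem[D TD] : root (T - T.[b]%:P) b.
  by rewrite rootE !hornerE subrr.
exists D; last first.
  by move=> z; have := congr1 (horner^~ z) TD; rewrite !hornerE.
have [->|D0] := eqVneq D 0; first by rewrite size_poly0.
rewrite -ltnS -addn1 -(_ : size (D * ('X - b%:P))%R = (size D + 1)%N); last first.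
  by rewrite size_Mmonic ?monicXsubC // size_XsubC addn2 addn1.
rewrite -TD (leq_trans (size_polyD _ _)) // geq_max Tsize leqnn size_polyN.
by rewrite (leq_trans (size_polyC_leq1 _)).
Qed.

(** With [D] the quotient of [T - T.[b]] by [z - b], one has 1 / (z - b) = (D / T) / (1 - T(b) / T),
    and T(b) / T has modulus below 1 on [E]. *)
Lemma approximable_pole_below b : cmod T.[b] < t ->
  appr (fun z => (z - b)^-1).
Proof.
move=> Tb; have [D sD TD] := pole_quotient b.
have q1 : cmod T.[b] / t < 1 by rewrite ltr_pdivrMr // mul1r.
have A1 : appr (fun z => D.[z] / T.[z] ^+ 1).
  by apply: approximable_rat; rewrite mul1n (leq_trans sD).
have A2 : appr (fun z => (T.[b])%:P.[z] / T.[z] ^+ 1).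
  by apply: approximable_rat; rewrite mul1n (leq_trans (size_polyC_leq1 _)).
have A3 := approximable_neumann Tmonic Tsize t0 cE ET q1 A2.
apply: (approximable_ext _ (approximable_mul t0 cE ET A1 (A3 _))).

  move=> z Ez; rewrite hornerC expr1.
  have Tz := T_neq0 t0 ET Ez.
  have TbN : T.[z] - T.[b] != 0.
    rewrite -cmod_gt0 (lt_le_trans _ (cmodB_ge _ _)) //.
    by rewrite subr_gt0 (ET Ez).
  have := TbN; rewrite TD mulf_eq0 negb_or => /andP[Dz zb].
  have -> : 1 - T.[b] / T.[z] = (T.[z] - T.[b]) / T.[z] by field.
  by rewrite TD; field; rewrite ?Dz ?zb ?Tz.
by move=> z Ez; rewrite hornerC expr1 cmodM cmodV (ET Ez).
Qed.

(** 1 / (z - b') is 1 / (z - b) times the geometric series of (b' - b) / (z - b), whose ratio is at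
    most [q] on [E]. *)
Lemma approximable_pole_move b b' q : q < 1 -> ~ E b -> ~ E b' ->
  (forall z, E z -> cmod (b' - b) <= q * cmod (z - b)) ->
  appr (fun z => (z - b)^-1) -> appr (fun z => (z - b')^-1).
Proof.
move=> q1 Eb Eb' bq A1.
have A2 := approximable_mul t0 cE ET (approximable_cst T n E (b' - b)) A1.
have nz c z : ~ E c -> E z -> z - c != 0.
  by move=> Ec Ez; rewrite subr_eq0; apply/eqP => zc; apply: Ec; rewrite -zc.
have A3 := approximable_neumann Tmonic Tsize t0 cE ET q1 A2.
apply: (approximable_ext _ (approximable_mul t0 cE ET A1 (A3 _))).

  move=> z Ez; have h1 := nz b z Eb Ez; have h2 := nz b' z Eb' Ez.
  have -> : 1 - (b' - b) / (z - b) = (z - b') / (z - b) by field.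
  by field; rewrite ?h1 ?h2.
move=> z Ez; have h1 := nz b z Eb Ez.
by rewrite cmodM cmodV ler_pdivrMr ?cmod_gt0 // bq.
Qed.

(** The last displacement, to infinity. Since 1 + b / (z - b) = z / (z - b) is at most M / (|b| - M)
    < 1 on [E], the series yields the inverse of - b / (z - b), an affine function of z. *)
Lemma approximable_coordinate b M : (forall z, E z -> cmod z <= M) -> 0 < M ->
  2 * M < cmod b -> appr (fun z => (z - b)^-1) -> appr (fun z => z).
Proof.
move=> EM M0 bM A1.
have A2 := approximable_mul t0 cE ET (approximable_cst T n E b) A1.
have A3 := approximable_add Tmonic Tsize t0 ET (approximable_cst T n E 1) A2.
have zb z : E z -> M < cmod (z - b).
  by move=> /EM zM; have := cmodB_ge b z; rewrite cmod_distC; lra.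
have zb0 z : E z -> z - b != 0 by move=> /zb H; rewrite -cmod_gt0; lra.
have b0 : b != 0 by rewrite -cmod_gt0; lra.
have q1 : M / (cmod b - M) < 1 by rewrite ltr_pdivrMr; lra.
have A4 := approximable_neumann Tmonic Tsize t0 cE ET q1 A3.
have A5 := approximable_add Tmonic Tsize t0 ET (A4 _) (approximable_cst T n E (-1)).
apply: (approximable_ext _ (approximable_mul t0 cE ET (approximable_cst T n E (- b)) (A5 _))).

  move=> z Ez; have h := zb0 z Ez.
  have -> : 1 - (1 + b / (z - b)) = - b / (z - b) by field.
  by field; rewrite ?h ?b0.
move=> z Ez; have h := zb0 z Ez.
have -> : 1 + b / (z - b) = z / (z - b) by field.
rewrite cmodM cmodV ler_pM ?cmod_ge0 ?invr_ge0 ?cmod_ge0 ?EM //.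
rewrite lef_pV2 ?posrE ?cmod_gt0 //; last by lra.
by rewrite cmod_distC (le_trans _ (cmodB_ge _ _)) // lerD2l lerN2 EM.
Qed.

Lemma closedE_dist b : ~ E b ->
  exists2 d : R, 0 < d & forall z, E z -> d <= cmod (z - b).
Proof.
move=> Eb; have /openCC/(_ b Eb)[d d0 sub] : open (~` E).
  by apply: closed_openC; exact: compact_closedCC.
by exists d => // z Ez; rewrite leNgt; apply/negP => /sub.
Qed.

(** The admissible poles form a nonempty subset of the component that is both open and relatively
    closed. *)
Lemma approximable_pole_component b c : appr (fun z => (z - b)^-1) -> ~ E b ->
  connected_component (~` E) b c -> appr (fun z => (z - c)^-1).
Proof.
move=> Ab Eb bc.
pose G := [set x : CC R | ~ E x /\ appr (fun z => (z - x)^-1)].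
have cl_in x : ~ E x -> exists2 d : R, 0 < d &
    forall y, cmod (y - x) < d -> (G x -> G y) /\ (G y -> G x).
  (* Within [d / 4] the ratio 1/2 works in both directions, as [y] keeps distance [3 / 4 * d] from
     [E]. Moving from [x] to [y] gives openness, from [y] to [x] closedness. *)
  move=> Ex; have [d d0 dE] := closedE_dist Ex; exists (d / 4).
    by rewrite divr_gt0.
  move=> y yx; have yE z : E z -> 3 / 4 * d <= cmod (z - y).
    move=> /dE zx; have := cmodB_ge (z - x) (y - x).
    have -> : z - x - (y - x) = z - y by ring.
    lra.
  have Ey : ~ E y by move=> /yE; rewrite subrr cmod0; lra.
  split=> -[_ A]; split=> //.
    apply: (@approximable_pole_move x y (1 / 2)) => // [|z /dE]; lra.
  apply: (@approximable_pole_move y x (1 / 2)) => // [|z /yE].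
    lra.
  by rewrite (cmod_distC x); lra.
have : connected_component (~` E) b `<=` G.
  apply: (@connected_clopen_sub _ _ _ b).
  - exact: component_connected.
  - exact: connected_component_refl.
  - by split.
  - apply/openCC => x Gx; have [d d0 Hd] := cl_in x Gx.1.
    by exists d => // y /Hd[+ _]; apply.
  - move=> x [/connected_component_sub Ex /closureCC clx].
    have [d d0 Hd] := cl_in x Ex; have [y Gy yx] := clx d d0.
    by have [_] := Hd y yx; apply.
by move=> /(_ c bc)[].
Qed.

(* The point at infinity and the poles of [S / T ^+ k] lie in one component
   of the complement of [E], so [z] is a uniform limit on [E] of functions
   finite at infinity: a function of value 1 at infinity that is small on [E]
   results. *)
Lemma small_monic_on_level : (0 < n)%N -> appr (fun z => z) ->
  exists k (Q : {poly CC R}), [/\ Q \is monic, size Q = (k * n).+1 &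
    forall z, E z -> cmod Q.[z] <= t ^+ k / 2].
Proof.
move=> n0 Az.
have /closed_rootP[x Tx] : size T != 1%N by rewrite Tsize eqSS -lt0n.
have [D sD] := pole_quotient x.
rewrite (rootP Tx) => TD.
have Ex : ~ E x by move=> /ET; rewrite (rootP Tx) cmod0 => t00; move: t0; rewrite -t00 ltxx.
have [d d0 dE] := closedE_dist Ex.
have /Az[k [S [sS HS]]] : 0 < d / 2 by rewrite divr_gt0.
(* On [E] this polynomial is [T ^+ k.+1] times (z - S / T^k) / (z - x). The second factor tends to 1
   at infinity, which makes the product monic, and on [E] it is at most (d / 2) / d. *)
exists k.+1, (T ^+ k.+1 + (x *: (D * T ^+ k) - S * D)).
have sz : (size (x *: (D * T ^+ k) - S * D)%R < size (T ^+ k.+1)%R)%N.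
  rewrite (sizeTX Tmonic Tsize) ltnS (leq_trans (size_polyD _ _)) // geq_max size_polyN.
  apply/andP; split.
    apply: leq_trans (size_scale_leq _ _) _.
    apply: leq_trans (size_polyMleq _ _) _.
    by rewrite (sizeTX Tmonic Tsize) mulSn addnS /= leq_add2r.
  apply: leq_trans (size_polyMleq _ _) _.
  by rewrite -subn1 leq_subLR (leq_trans (leq_add sS sD)) // mulSn; lia.
split.
- by rewrite monicE lead_coefDl // lead_coef_exp (monicP Tmonic) expr1n.
- by rewrite size_polyDl // (sizeTX Tmonic Tsize).
move=> z Ez; have Tz := T_neq0 t0 ET Ez.
have zx : z - x != 0 by rewrite -cmod_gt0 (lt_le_trans d0) // dE.
have DE : D.[z] = T.[z] / (z - x).
  by have := TD z; rewrite subr0 => ->; rewrite mulfK.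
have -> : (T ^+ k.+1 + (x *: (D * T ^+ k) - S * D)).[z]
    = T.[z] ^+ k.+1 * ((z - S.[z] / T.[z] ^+ k) / (z - x)).
  rewrite !(hornerD, hornerN, hornerZ, hornerM, horner_exp) DE exprS.
  by field; rewrite ?zx ?expf_neq0.
rewrite cmodM cmodX ET // ler_wpM2l ?exprn_ge0 ?(ltW t0) //.
rewrite cmodM cmodV ler_pdivrMr ?cmod_gt0 // (le_trans (HS z Ez)) //.
have := dE z Ez; lra.
Qed.

End Algebra.

Lemma small_monic e (T : {poly CC R}) (n : nat) (t : R) z :
  T \is monic -> size T = n.+1 -> (0 < n)%N -> 0 < t ->
  compact e -> (forall z, e z -> cmod T.[z] <= t) ->
  unbounded_component e z -> cmod T.[z] <= t ->
  exists k (Q : {poly CC R}), [/\ (0 < k)%N, Q \is monic, size Q = (k * n).+1 &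
    forall z, e z -> cmod Q.[z] < t ^+ k].
Proof.
move=> Tmonic Tsize n0 t0 ce eT [ez ubz] Tz.
have T1 : (1 < size T)%N by rewrite Tsize.
pose E := e `&` [set u : CC R | cmod T.[u] = t].
have cE : compact E.
  apply: (subclosed_compact _ ce); last by move=> u [].
  apply: closedI; first exact: compact_closedCC.
  rewrite (_ : mkset _ = (fun u => cmod T.[u]) @^-1` [set x : R | x = t]) //.
  apply: closed_comp => [u _|]; first exact: cmod_horner_cont.
  exact: closed_eq.
have ET u : E u -> cmod T.[u] = t by case.
set W := connected_component (~` e) z in ubz.
have [w Ww Tw] : exists2 w, W w & t < cmod T.[w].
  have [M M0 HM] := poly_coercive t T1.
  apply: contrapT => H; apply: ubz; apply/bounded_setCC; exists M => u Wu.
  by rewrite leNgt; apply/negP => /HM uM; apply: H; exists u.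
(* The connected set [W] has points on both sides of the level [t], so it crosses it. The disc
   around [z0] that misses [e] is the gap. *)
have [z0 Wz0 Tz0] : exists2 z0, W z0 & cmod T.[z0] = t.
  apply: contrapT => H.
  have WN u : W u -> cmod T.[u] != t.
    by move=> Wu; apply/eqP => Tu; apply: H; exists u.
  have : W `<=` [set u : CC R | cmod T.[u] < t].
    apply: (@connected_clopen_sub _ _ _ z).
    - exact: component_connected.
    - exact: connected_component_refl.
    - by rewrite /= lt_neqAle Tz andbT WN //; exact: connected_component_refl.
    - exact: open_lt_modulus.
    - move=> u [Wu clu] /=; rewrite ltNge; apply/negP => tu.
      have /openCC/(_ u)[] := @open_gt_modulus _ T t.
        by rewrite /= lt_neqAle tu eq_sym WN.
      move=> r r0 sub; have [u' /= Tu' /sub /=] := (closureCC _ _).1 clu r r0.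
      by rewrite ltNge (ltW Tu').
  by move=> /(_ w Ww) /=; rewrite ltNge (ltW Tw).
have [r r0 sub] : exists2 r, 0 < r & forall u, cmod (u - z0) < r -> ~ e u.
  apply: (openCC (~` e)).1; last exact: connected_component_sub Wz0.
  by apply: closed_openC; exact: compact_closedCC.
(* [z1] lies below the level, where poles are available at once; [z2] lies above it, where the
   component of the superlevel set leads to infinity. *)
have [z2 z2r Tz2] := @modulus_increase _ T z0 (r / 4) T1 (divr_gt0 r0 (ltr0n _ 4)).
have [|z1 z1r Tz1] := @modulus_decrease _ T z0 (r / 4) T1 _ (divr_gt0 r0 (ltr0n _ 4)).
  by rewrite -cmod_gt0 Tz0.
rewrite Tz0 in Tz1 Tz2.
have nE1 : ~ E z1 by case=> _ /= Tz1'; move: Tz1; rewrite Tz1' ltxx.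
have nE2 : ~ E z2 by case=> _ /= Tz2'; move: Tz2; rewrite Tz2' ltxx.
have A1 := approximable_pole_below Tmonic Tsize t0 cE ET Tz1.
have A2 : approximable T n E (fun u => (u - z2)^-1).
  (* The points [z1] and [z2] are less than [r / 2] apart, while [E] stays at distance more than
     [3 / 4 * r] from [z1]: hence the ratio 2/3. *)
  apply: (approximable_pole_move Tmonic Tsize t0 cE ET (q := 2 / 3) _ nE1 nE2 _ A1).
    lra.
  move=> u [eu _].
  have uz : r <= cmod (u - z0) by rewrite leNgt; apply/negP => /sub.
  have := cmodB_ge (u - z0) (z1 - z0).
  have -> : u - z0 - (z1 - z0) = u - z1 by ring.
  have := cmodD (z2 - z0) (z0 - z1).
  rewrite addrA subrK (cmod_distC z0 z1); lra.
have [M M0 HM] := compact_bound 'X cE.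
have [b bz2 bM] := superlevel_component_unbounded T1 Tz2 (2 * M).
have A3 : approximable T n E (fun u => (u - b)^-1).
  apply: (approximable_pole_component Tmonic Tsize t0 cE ET A2 nE2).
  have [B [Bz BT Bc] Bb] := bz2; exists B => //; split=> // u /BT /= tu [_ /= Eu].
  by move: tu; rewrite Eu ltxx.
have A4 : approximable T n E (fun u => u).
  apply: (approximable_coordinate Tmonic Tsize t0 cE ET (M := M) _ M0 bM A3).
  by move=> u /HM; rewrite hornerX.
have [k [Q [Qm Qs HQ]]] := small_monic_on_level Tmonic Tsize t0 cE ET n0 A4.
(* Any factor strictly between 1/2 and 1 would serve: above 1/2, [e'] is disjoint from [E], so that
   [T] stays below some [t' < t] on it; below 1, [Q] alone is small enough off [e']. *)
pose e' := e `&` [set u : CC R | 3 / 4 * t ^+ k <= cmod Q.[u]].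
have ce' : compact e'.
  apply: (subclosed_compact _ ce); last by move=> u [].
  apply: closedI; first exact: compact_closedCC.
  rewrite (_ : mkset _ = (fun u => cmod Q.[u]) @^-1` [set x : R | 3 / 4 * t ^+ k <= x]) //.
  apply: closed_comp => [u _|]; first exact: cmod_horner_cont.
  exact: closed_ge.
have tk0 : 0 < t ^+ k by rewrite exprn_gt0.
have [t' [t'0 t't He']] : exists t', [/\ 0 <= t', t' < t & forall u, e' u -> cmod T.[u] <= t'].
  have [->|/set0P e'0] := eqVneq e' set0; first by exists 0.
  have [u [eu /= Qu] Hu] := compact_modulus_max T ce' e'0.
  exists (cmod T.[u]); split=> //; first exact: cmod_ge0.
  rewrite lt_neqAle eT // andbT; apply/eqP => Tu.
  have /HQ : E u by split.
  move: Qu; lra.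
have [MQ MQ0 HMQ] := compact_bound Q ce.
have [|||m Hm] := @exprn_small _ (t' / t) (t ^+ k / MQ).
- by rewrite divr_ge0 // ltW.
- by rewrite ltr_pdivrMr // mul1r.
- by rewrite divr_gt0.
(* The power [m] of [T] makes up for the size of [Q] on [e']; the extra factor costs at most [t] and
   makes the exponent positive for every [k]. *)
exists (k + m.+1)%N, (Q * T ^+ m.+1); split; first by rewrite addnS.
- by rewrite monicMl // monic_exp.
- rewrite (size_Mmonic (monic_neq0 Qm) (monic_exp m.+1 Tmonic)).
  by rewrite Qs (sizeTX Tmonic Tsize) addnS /= addSn mulnDl.
move=> u eu; rewrite hornerM horner_exp cmodM cmodX exprD.
have tm0 j : 0 < t ^+ j by rewrite exprn_gt0.
have [Qu|Qu] := ltP (cmod Q.[u]) (3 / 4 * t ^+ k).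
  have : cmod T.[u] ^+ m.+1 <= t ^+ m.+1 by rewrite lerXn2r ?nnegrE ?cmod_ge0 ?(ltW t0) ?eT.
  move=> /(ler_wpM2l (cmod_ge0 Q.[u])) /le_lt_trans; apply.
  by rewrite ltr_pM2r // (lt_trans Qu) //; lra.
have Tu : cmod T.[u] <= t' by apply: He'; split.
have Tum : cmod T.[u] ^+ m <= t' ^+ m by rewrite lerXn2r ?nnegrE ?cmod_ge0.
rewrite !exprSr !mulrA.
have H1 : cmod Q.[u] * cmod T.[u] ^+ m < t ^+ k * t ^+ m.
  apply: (@le_lt_trans _ _ (MQ * t' ^+ m)).
    by rewrite ler_pM ?cmod_ge0 ?exprn_ge0 ?cmod_ge0 ?HMQ.
  move: Hm; rewrite expr_div_n ltr_pdivrMr // mulrAC ltr_pdivlMr //.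
  by rewrite mulrC.
have H2 := eT u eu; have H3 := tm0 m.
rewrite (@le_lt_trans _ _ (cmod Q.[u] * cmod T.[u] ^+ m * t)) //.
  by rewrite ler_wpM2l // mulr_ge0 ?exprn_ge0 ?cmod_ge0.
by rewrite ltr_pM2r.
Qed.

End Poles.

(** * The outer boundary *)

Section Outer.
Variable R : realType.
Implicit Types (z w b : CC R) (r : R) (e : set (CC R)).

(** The superlevel set misses [e], and all its components are unbounded. *)
Lemma superlevel_sub_outer e (p : {poly CC R}) (t : R) : (1 < size p)%N ->
  (forall z, e z -> cmod p.[z] <= t) ->
  [set z | t < cmod p.[z]] `<=` unbounded_component e.
Proof.
move=> p1 ep z tz.
have sub : [set u | t < cmod p.[u]] `<=` ~` e.
  by move=> u /= tu eu; have := ep u eu; rewrite leNgt tu.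
split; first exact: sub.
move=> /bounded_setCC[M HM].
have [w [B [Bz Bt Bc] Bw] Mw] := superlevel_component_unbounded p1 tz M.
have : cmod w <= M by apply: HM; exists B => //; split=> // u /Bt /sub.
by rewrite leNgt Mw.
Qed.

Lemma outer_open e : closed e -> open (unbounded_component e).
Proof.
move=> cle; apply/openCC => z [ez uz].
have [r r0 sub] := (openCC _).1 (closed_openC cle) z ez.
exists r => // w wz.
have zw : connected_component (~` e) z w.
  apply: ball_in_component sub wz; exact: connected_component_refl.
by split; [exact: sub|rewrite -(same_connected_component zw)].
Qed.

Lemma outer_far e : compact e -> exists M : R, forall z, M < cmod z ->
  unbounded_component e z.
Proof.
move=> ce; have [M M0 HM] := compact_bound 'X ce; exists M => z zM.
apply: (superlevel_sub_outer (p := 'X)) HM _ _; first by rewrite size_polyX.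
by rewrite /= hornerX.
Qed.

(** A point off [e] has a disc inside a single component of the complement. If the unbounded
    component comes arbitrarily near, it contains that disc, and the point is interior. *)
Lemma outer_boundary_sub e : closed e -> outer_boundary e `<=` e.
Proof.
move=> cle z [clz nint]; apply: contrapT => ez; apply: nint.
have [r r0 sub] := (openCC _).1 (closed_openC cle) z ez.
have [w [ew uw] wz] := (closureCC _ _).1 clz r r0.
apply/nbhsCC; exists r => // w' w'z.
have zz : connected_component (~` e) z z by exact: connected_component_refl.
have zw := ball_in_component zz sub wz.
have zw' := ball_in_component zz sub w'z.
split; first exact: sub.
by rewrite -(same_connected_component zw') (same_connected_component zw).
Qed.

(** No point is a local maximum of the modulus, so each point of the level set is a limit of points
    above it. *)
Lemma superlevel_boundary (p : {poly CC R}) (t : R) : (1 < size p)%N ->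
  topological_boundary [set z | t < cmod p.[z]] = [set z | cmod p.[z] = t].
Proof.
move=> p1; rewrite /topological_boundary.
rewrite (_ : interior _ = [set z | t < cmod p.[z]]); last first.
  by apply/(interior_id _).1; exact: open_gt_modulus.
rewrite eqEsubset; split=> z /=.
  move=> [/closureCC clz /negP]; rewrite -leNgt => zt; apply/eqP.
  rewrite eq_le zt /= leNgt; apply/negP => lt_zt.
  have [r r0 sub] := (openCC _).1 (@open_lt_modulus _ p t) z lt_zt.
  have [w /= tw /sub /=] := clz r r0.
  by rewrite ltNge (ltW tw).
move=> zt; split; last by rewrite zt ltxx.
apply/closureCC => r r0; have [w wz zw] := modulus_increase z p1 r0.
by exists w => //=; rewrite -zt.
Qed.

(** If [z] in [e] had modulus above 1, its component in the set where [p] exceeds 1 would reach far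
    points, hence meet the unbounded component. It avoids the outer boundary, so it would lie
    entirely in the unbounded component, [z] included. *)
Lemma outer_boundary_lemniscate e (p : {poly CC R}) : compact e ->
  (1 < size p)%N -> outer_boundary e = [set z | cmod p.[z] = 1] ->
  forall z, e z -> cmod p.[z] <= 1.
Proof.
move=> ce p1 ob z ez; rewrite leNgt; apply/negP => pz.
have cle := compact_closedCC ce.
have [M HM] := outer_far ce.
have [w Ww Mw] := superlevel_component_unbounded p1 pz M.
set W := connected_component _ _ in Ww.
suff /(_ z) : W `<=` unbounded_component e.
  by move=> /(_ (connected_component_refl _))[] //; exact: pz.
apply: (@connected_clopen_sub _ _ _ w).
- exact: component_connected.
- exact: Ww.
- exact: HM.
- exact: outer_open.
- move=> x [/connected_component_sub /= px clx]; apply: contrapT => nx.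
  have : outer_boundary e x by split=> // /interior_subset.
  by rewrite ob /= => px1; rewrite px1 ltxx in px.
Qed.

Lemma infinite_sup_norm_gt0 e (p : {poly CC R}) : compact e ->
  ~ finite_set e -> p != 0 -> 0 < sup_norm e (horner p).
Proof.
move=> ce einf p0; have [z ez pz] : exists2 z, e z & p.[z] != 0.
  apply: contrapT => H; apply: einf.
  have [rs rsP] := closed_field_poly_normal p.
  apply: (@sub_finite_set _ _ [set` rs]); last exact: finite_seq.
  move=> z ez /=; have : root p z.
    by apply/eqP; apply: contrapT => /eqP pz; apply: H; exists z.
  by rewrite rsP rootZ ?lead_coef_eq0 // root_prod_XsubC.
by rewrite (lt_le_trans _ (sup_norm_ub p ce ez)) // cmod_gt0.
Qed.

Lemma infinite_neq0 e : ~ finite_set e -> e !=set0.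
Proof. by move=> einf; apply/set0P/eqP => e0; apply: einf; rewrite e0. Qed.

End Outer.

(** * Logarithmic energy *)

Section Energy.
Variable R : realType.
Implicit Types (z w b : CC R) (r : R) (e : set (CC R)).

Lemma open_measurableCC (A : set (CC R)) : open A -> measurable (A : set (borelCC R)).
Proof. exact: sub_sigma_algebra. Qed.

Lemma closed_measurableCC (A : set (CC R)) : closed A -> measurable (A : set (borelCC R)).
Proof.
move=> cA; rewrite -[A]setCK; apply: measurableC; apply: open_measurableCC.
exact: closed_openC.
Qed.

Lemma continuous_measurableCC (f : CC R -> R) : continuous f ->
  measurable_fun setT (f : borelCC R -> R).
Proof.
move=> /continuousP cf; apply: (measurability _ (RGenOpens.measurableE R)).
move=> _ [_ [a [b ->] <-]]; rewrite setTI; apply: open_measurableCC.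
by apply: cf; exact: interval_open.
Qed.

Lemma cRe_cont : continuous (@cRe R).
Proof.
move=> z A /nbhs_ballP[r r0 sub]; apply/nbhsCC; exists r => // w wz.
apply: sub; rewrite /ball /= distrC -cReB.
exact: le_lt_trans (Re_le_cmod _) wz.
Qed.

Lemma cIm_cont : continuous (@cIm R).
Proof.
move=> z A /nbhs_ballP[r r0 sub]; apply/nbhsCC; exists r => // w wz.
apply: sub; rewrite /ball /= distrC -cImB.
exact: le_lt_trans (Im_le_cmod _) wz.
Qed.

Lemma measurable_cRe : measurable_fun setT (@cRe R : borelCC R -> R).
Proof. by apply: continuous_measurableCC; exact: cRe_cont. Qed.

Lemma measurable_cIm : measurable_fun setT (@cIm R : borelCC R -> R).
Proof. by apply: continuous_measurableCC; exact: cIm_cont. Qed.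

Lemma cmod_ReIm z : cmod z = Num.sqrt (cRe z ^+ 2 + cIm z ^+ 2).
Proof. by case: z. Qed.

(** Real and imaginary parts are used because the energy kernel lives on a product of two Borel
    sigma-algebras, where continuity does not give measurability by itself. *)
Lemma measurable_cmod_ReIm d (X : measurableType d) (f : X -> CC R) :
  measurable_fun setT (fun x => cRe (f x)) ->
  measurable_fun setT (fun x => cIm (f x)) ->
  measurable_fun setT (fun x => cmod (f x)).
Proof.
move=> mRe mIm.
rewrite (_ : (fun x => cmod (f x)) =
    Num.sqrt \o (fun x => cRe (f x) ^+ 2 + cIm (f x) ^+ 2)); last first.
  by apply/funext => x; exact: cmod_ReIm.
apply: measurableT_comp; first by apply: continuous_measurable_fun; exact: sqrt_continuous.
by apply: measurable_funD; exact: measurable_funX.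
Qed.

Lemma measurable_lne_fun d (X : measurableType d) (f : X -> R) :
  measurable_fun setT f -> measurable_fun setT (fun x => lne (f x)%:E).
Proof.
move=> mf; rewrite /lne; apply: measurable_fun_if => //.
- exact: measurable_fun_ler.
- by apply/measurable_EFinP; apply: measurable_funTS; exact: measurableT_comp.
Qed.

Definition log_kernel (x : borelCC R * borelCC R) : \bar R :=
  (- lne (cmod (x.1 - x.2 : CC R))%:E)%E.

Lemma measurable_log_kernel : measurable_fun setT log_kernel.
Proof.
apply: measurableT_comp => //; apply: measurable_lne_fun.
apply: measurable_cmod_ReIm.
  rewrite (_ : (fun _ => _) = (fun x : borelCC R * borelCC R => cRe x.1 - cRe x.2)).
    by apply: measurable_funB; apply: measurableT_comp => //; exact: measurable_cRe.
  by apply/funext => x; rewrite cReB.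
rewrite (_ : (fun _ => _) = (fun x : borelCC R * borelCC R => cIm x.1 - cIm x.2)).
  by apply: measurable_funB; apply: measurableT_comp => //; exact: measurable_cIm.
by apply/funext => x; rewrite cImB.
Qed.

(* The cut-off is inactive on points at distance at most [expR c], and a
   nonnegative kernel makes Tonelli's theorem available. *)
Definition shift_kernel (c : R) (x : borelCC R * borelCC R) : \bar R :=
  maxe 0%E (log_kernel x + c%:E)%E.

Lemma measurable_shift_kernel c : measurable_fun setT (shift_kernel c).
Proof.
apply: measurable_maxe => //; apply: emeasurable_funD => //.
exact: measurable_log_kernel.
Qed.

Lemma shift_kernel_ge0 c x : (0 <= shift_kernel c x)%E.
Proof. by rewrite /shift_kernel le_max lexx. Qed.

Lemma log_kernel_shift c (z w : CC R) : cmod (z - w) <= expR c ->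
  log_kernel (z, w) = (shift_kernel c (z, w) - c%:E)%E.
Proof.
move=> zw; rewrite /shift_kernel.
have H : (- c%:E <= log_kernel (z, w))%E.
  by rewrite leeN2 -lee_expeR lneK ?lee_fin // in_itv /= lee_fin cmod_ge0 leey.
have H0 : (0 <= log_kernel (z, w) + c%:E)%E.
 by rewrite -leeBlDr // sub0e.
rewrite (max_r H0).
by rewrite addeK.
Qed.

End Energy.

(** * Integrals against a probability carried by a set *)

Section Integrals.
Context d (X : measurableType d) (R : realType).
Variables (mu : probability X R) (D : set X).
Hypotheses (mD : measurable D) (muD : mu D = 1%E).

Let muDC : mu (~` D) = 0%E.
Proof. by rewrite probability_setC // muD subee. Qed.

Lemma ge0_integral_carrier (f : X -> \bar R) : measurable_fun setT f ->
  (forall x, (0 <= f x)%E) -> (\int[mu]_x f x = \int[mu]_(x in D) f x)%E.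
Proof.
move=> mf f0; rewrite (@ge0_negligible_integral _ _ _ mu setT (~` D)) //.
  by rewrite setDE setCK setTI.
exact: measurableC.
Qed.

Lemma integral_carrier (f : X -> \bar R) : measurable_fun setT f ->
  (\int[mu]_x f x = \int[mu]_(x in D) f x)%E.
Proof.
move=> mf; rewrite integralE [RHS]integralE.
by congr (_ - _)%E; apply: ge0_integral_carrier => //;
  [exact: measurable_funepos|exact: measurable_funeneg].
Qed.

(** The integral of [g] may be infinite, which excludes linearity for integrable functions. With h =
    g - c, the identity h^+ + c = g + h^- involves nonnegative functions only, and the integral of
    h^- is at most [c]. *)
Lemma ge0_integral_shift (g : X -> \bar R) (c : R) : measurable_fun setT g ->
  (forall x, (0 <= g x)%E) -> 0 <= c ->
  (\int[mu]_(x in D) (g x - c%:E) = \int[mu]_(x in D) g x - c%:E)%E.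
Proof.
move=> mg g0 c0; set h := (fun x => g x - c%:E)%E.
have mh : measurable_fun D h.
  by apply: measurable_funTS; apply: emeasurable_funB.
have mgD : measurable_fun D g by exact: measurable_funTS.
have intc : (\int[mu]_(x in D) (cst c%:E) x = c%:E)%E.
  transitivity (c%:E * mu D)%E; first exact: integral_cst.
  by rewrite muD mule1.
have hneg x : (h^\- x <= c%:E)%E.
  rewrite funenegE ge_max lee_fin c0 andbT /h fin_num_oppeB //.
  by apply: geeDr; rewrite oppe_le0.
have negfin : (\int[mu]_(x in D) h^\- x)%E \is a fin_num.
  rewrite ge0_fin_numE; last by apply: integral_ge0.
  apply: (@le_lt_trans _ _ c%:E); last exact: ltry.
  rewrite -intc; apply: ge0_le_integral => //.
  exact: measurable_funeneg.
have E1 : (\int[mu]_(x in D) (h^\+ x + cst c%:E x) =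
           \int[mu]_(x in D) (g x + h^\- x))%E.
  apply: eq_integral => x _; rewrite funeposE funenegE /h /=.
  have := g0 x; case: (g x) => [r| |] //= r0; last first.
    rewrite addye // !maxElt. by rewrite ltNyr adde0.
  rewrite -!EFinD -!EFin_max -!EFinD; congr EFin.
  by rewrite !maxElt; do 2!case: ifPn; rewrite -?leNgt; lra.
rewrite integralE.
move: E1; rewrite !ge0_integralD // ?intc; last 2 first.
- exact: measurable_funeneg.
- exact: measurable_funepos.
rewrite -(fineK negfin); move: (fine _) => q E1.
rewrite -[X in (X - q%:E)%E](@addeK _ c%:E) // E1.
by rewrite addeAC addeK.
Qed.

End Integrals.

Section LogEnergy.
Variable R : realType.
Implicit Types (z w b : CC R) (r : R) (e : set (CC R)).

Definition potential (mu : probability (borelCC R) R) (c : R) (z : borelCC R) : \bar R :=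
  (\int[mu]_w shift_kernel c (z, w))%E.

Lemma measurable_section (k : borelCC R * borelCC R -> \bar R) (z : borelCC R) :
  measurable_fun setT k -> measurable_fun setT (fun w : borelCC R => k (z, w)).
Proof. by move=> mk; apply: measurableT_comp. Qed.

Lemma potential_ge0 mu c z : (0 <= potential mu c z)%E.
Proof. by apply: integral_ge0 => w _; exact: shift_kernel_ge0. Qed.

Lemma measurable_potential mu c : measurable_fun setT (potential mu c).
Proof.
apply: (@measurable_fun_fubini_tonelli_F _ _ _ _ _ mu (shift_kernel c)).
  exact: measurable_shift_kernel.
by move=> x; exact: shift_kernel_ge0.
Qed.

Lemma measurable_log_potential (mu : probability (borelCC R) R) :
  measurable_fun setT (fun z : borelCC R => \int[mu]_w log_kernel (z, w))%E.
Proof.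
have mk := @measurable_log_kernel R.
rewrite (_ : (fun z : borelCC R => _) = (fun z : borelCC R =>
    \int[mu]_w ((@log_kernel R)^\+ (z, w)) - \int[mu]_w ((@log_kernel R)^\- (z, w))))%E.
  apply: emeasurable_funB.
    apply: (@measurable_fun_fubini_tonelli_F _ _ _ _ _ mu ((@log_kernel R)^\+)%E).
      exact: measurable_funepos.
    by move=> x; exact: funepos_ge0.
  apply: (@measurable_fun_fubini_tonelli_F _ _ _ _ _ mu ((@log_kernel R)^\-)%E).
    exact: measurable_funeneg.
  by move=> x; exact: funeneg_ge0.
apply/funext => z; rewrite integralE.
by congr (_ - _)%E; apply: eq_integral => w _; rewrite ?funeposE ?funenegE.
Qed.

(** Trades a signed iterated integral for a nonnegative one; [c] is subtracted just once because
    [mu] has mass 1. *)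
Lemma log_energy_shift (mu : probability (borelCC R) R) e (c : R) :
  measurable (e : set (borelCC R)) -> mu e = 1%E -> 0 <= c ->
  (forall z w, e z -> e w -> cmod (z - w) <= expR c) ->
  log_energy mu = (\int[mu]_z potential mu c z - c%:E)%E.
Proof.
move=> me mue c0 ec.
transitivity (\int[mu]_z \int[mu]_w log_kernel (z, w))%E; first by [].
rewrite (integral_carrier me mue (measurable_log_potential mu)).
transitivity (\int[mu]_(z in e) (potential mu c z - c%:E))%E.
  apply: eq_integral => z /set_mem ez.
  have mk := @measurable_log_kernel R.
  have msk := @measurable_shift_kernel R c.
  rewrite (integral_carrier me mue (measurable_section z mk)).
  rewrite /potential (ge0_integral_carrier me mue (measurable_section z msk)); last first.
    by move=> w; exact: shift_kernel_ge0.
  rewrite -(ge0_integral_shift me mue (measurable_section z msk)) //; last first.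
    by move=> w; exact: shift_kernel_ge0.
  by apply: eq_integral => w /set_mem ew; rewrite (log_kernel_shift (c := c)) // ec.
rewrite (ge0_integral_shift me mue (measurable_potential mu c)) //; last first.
  by move=> z; exact: potential_ge0.
rewrite (ge0_integral_carrier me mue (measurable_potential mu c)) //.
by move=> z; exact: potential_ge0.
Qed.

End LogEnergy.

(** * From discrete energies to the energy of a measure *)

Section Peel.
Variable R : realType.
Variables (mu : probability (borelCC R) R) (e : set (CC R)) (c : R).
Hypotheses (me : measurable (e : set (borelCC R))) (mue : mu e = 1%E).

(** Shifted energy of a finite configuration, each unordered pair counted once. Removing the head
    mirrors the averaging of one point. *)
Fixpoint pair_energy (s : seq (CC R)) : \bar R :=
  if s is x :: s' then (\sum_(y <- s') shift_kernel c (y, x) + pair_energy s')%E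
  else 0%E.

Let sum_ge0 (s : seq (CC R)) x : (0 <= \sum_(y <- s) shift_kernel c (y, x))%E.
Proof. by apply: sume_ge0 => y _; exact: shift_kernel_ge0. Qed.

Lemma pair_energy_ge0 s : (0 <= pair_energy s)%E.
Proof. by elim: s => //= x s IH; rewrite adde_ge0. Qed.

Let U := potential mu c.
Let I := (\int[mu]_z U z)%E.

(* The points of [s] are frozen and the [b] others averaged out, one at a
   time. *)
Lemma pair_energy_average (M : \bar R) (N : nat) :
  (forall s, size s = N -> (forall x, x \in s -> e x) -> (M <= pair_energy s)%E) ->
  forall b s, (size s + b)%N = N -> (forall x, x \in s -> e x) ->
  (M <= pair_energy s + b%:R%:E * \sum_(y <- s) U y + 'C(b, 2)%:R%:E * I)%E.
Proof.
move=> HM; have U0 z : (0 <= U z)%E by exact: potential_ge0.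
have I0 : (0 <= I)%E by exact: integral_ge0.
have mU : measurable_fun setT U by exact: measurable_potential.
elim=> [|b IH] s sN es.
  rewrite mul0e adde0 bin0n /= mul0e adde0; apply: HM => //.
  by rewrite -sN addn0.
have S0 : (0 <= \sum_(y <- s) U y)%E by apply: sume_ge0 => y _.
have {}IH x : e x -> (M <= (\sum_(y <- s) shift_kernel c (y, x) + pair_energy s)
   + b%:R%:E * (U x + \sum_(y <- s) U y) + 'C(b, 2)%:R%:E * I)%E.
  move=> ex; have := IH (x :: s); rewrite big_cons /=; apply.
    by rewrite addSn -addnS.
  by move=> y; rewrite inE => /predU1P[->|/es].
pose K := (pair_energy s + b%:R%:E * \sum_(y <- s) U y + 'C(b, 2)%:R%:E * I)%E.
have K0 : (0 <= K)%E by rewrite !adde_ge0 ?mule_ge0 ?pair_energy_ge0 ?lee_fin.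
have ms y : measurable_fun setT (fun x : borelCC R => shift_kernel c (y, x)).
  by apply: measurable_section; exact: measurable_shift_kernel.
(* The inductive bound for [x :: s] as a function of [x]. Integrated, its terms in [x] give one more
   potential for each frozen point and [b] more copies of [I], in accordance with Pascal's rule for
   ['C(b.+1, 2)]. *)
pose f (x : borelCC R) := (\sum_(y <- s) shift_kernel c (y, x) + (b%:R%:E * U x + K))%E.
have bU x : (0 <= b%:R%:E * U x)%E by rewrite mule_ge0 ?lee_fin.
have bUK x : (0 <= b%:R%:E * U x + K)%E by exact: adde_ge0.
have mS : measurable_fun setT (fun x => \sum_(y <- s) shift_kernel c (y, x))%E.
  by apply: emeasurable_sum => y; exact: ms.
have mbU : measurable_fun setT (fun x => b%:R%:E * U x)%E by apply: measurable_funeM.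
have mbUK : measurable_fun setT (fun x => b%:R%:E * U x + K)%E.
  exact: emeasurable_funD.
have mf : measurable_fun setT f by exact: emeasurable_funD.
have f0 x : (0 <= f x)%E by exact: adde_ge0.
have Mf x : e x -> (M <= f x)%E.
  move=> ex; apply: (le_trans (IH x ex)); rewrite /f /K ge0_muleDr //.
  rewrite le_eqVlt; apply/orP; left; apply/eqP.
  by rewrite -!addeA; congr (_ + _)%E; rewrite addeCA.
have -> : (pair_energy s + b.+1%:R%:E * \sum_(y <- s) U y + 'C(b.+1, 2)%:R%:E * I
    = \int[mu]_x f x)%E.
  rewrite /f ge0_integralD // ge0_integralD //.
  rewrite ge0_integral_sum //; last first.
    by move=> y x _; exact: shift_kernel_ge0.
  rewrite ge0_integralZl ?lee_fin //.
  rewrite (_ : \int[mu]_x K = K)%E; last first.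
    transitivity (K * mu setT)%E; first exact: integral_cst.
    by rewrite probability_setT mule1.
  rewrite /K binS bin1 natrD EFinD ge0_muleDl ?lee_fin //.
  rewrite -natr1 EFinD ge0_muleDl ?lee_fin // mul1e.
  rewrite -/I (_ : (\sum_(y <- s) \int[mu]_x shift_kernel c (y, x) = \sum_(y <- s) U y)%E) //.
  set A := pair_energy s; set S := (\sum_(y <- s) U y)%E.
  rewrite -!addeA [RHS]addeCA -(addeCA A) [RHS]addeC -!addeA.
  by congr (_ + _)%E; rewrite addeCA.
(* Comparison of integrals over [e] requires a nonnegative minorant; for [M <= 0] the bound is
   trivial. *)
have [M0|M0] := leP M 0%E; first by rewrite (le_trans M0) // integral_ge0.
rewrite (ge0_integral_carrier me mue mf) //.
apply: (@le_trans _ _ (\int[mu]_(x in e) cst M x)%E).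
  rewrite (_ : \int[mu]_(x in e) cst M x = M)%E //.
  transitivity (M * mu e)%E; first exact: integral_cst.
  by rewrite mue mule1.
apply: ge0_le_integral => //.
- by move=> x _; exact: ltW.
- exact: measurable_funTS.
Qed.

Lemma pair_energy_min (M : \bar R) (N : nat) :
  (forall s, size s = N -> (forall x, x \in s -> e x) -> (M <= pair_energy s)%E) ->
  (M <= 'C(N, 2)%:R%:E * \int[mu]_z potential mu c z)%E.
Proof.
move=> HM; have := pair_energy_average HM (b := N) (s := [::]) erefl.
by rewrite big_nil mule0 /= !add0e; apply.
Qed.

End Peel.

(** * Vandermonde determinants and the bound C(e)^m <= ||Q|| *)

Section Vandermonde.
Variable R : realType.
Implicit Types (z w b : CC R) (r : R) (e : set (CC R)).

Fixpoint pair_product (s : seq (CC R)) : R :=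
  if s is x :: s' then (\prod_(y <- s') cmod (y - x)) * pair_product s' else 1.

Lemma pair_productE (s : seq (CC R)) : pair_product s =
  \prod_(i < size s) \prod_(j < size s | (i < j)%N) cmod (s`_j - s`_i).
Proof.
elim: s => [|x s IH] /=; first by rewrite big_ord0.
rewrite big_ord_recl; congr (_ * _).
  rewrite [RHS]big_mkcond big_ord_recl /= mul1r (big_nth 0) big_mkord.
  by apply: eq_bigr.
rewrite IH; apply: eq_bigr => i _.
rewrite [RHS]big_mkcond big_ord_recl /= mul1r [LHS]big_mkcond.
by apply: eq_bigr => j _.
Qed.

Lemma pair_product_det (s : seq (CC R)) : pair_product s =
  cmod (\det (Vandermonde (size s) (\row_(j < size s) s`_j))).
Proof.
rewrite det_Vandermonde cmod_prod pair_productE; apply: eq_bigr => i _.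
by rewrite cmod_prod; apply: eq_bigr => j _; rewrite !mxE.
Qed.

(** Each of the n! terms of the Leibniz expansion takes one entry from every row, so row bounds
    suffice. *)
Lemma det_le_fact n (A : 'M[CC R]_n) (B : 'I_n -> R) :
  (forall i j, cmod (A i j) <= B i) -> cmod (\det A) <= n`!%:R * \prod_i B i.
Proof.
move=> HB; rewrite (le_trans (cmod_sum _ _ _)) //.
apply: (@le_trans _ _ (\sum_(s : 'S_n) \prod_i B i)).
  apply: ler_sum => s _; rewrite cmodM cmodX cmodN cmod1 expr1n mul1r cmod_prod.
  by apply: ler_prod => i _; rewrite cmod_ge0 HB.
rewrite sumr_const.
rewrite -(card_Sn n) le_eqVlt; apply/orP; left; apply/eqP.
by rewrite mulr_natl; congr (_ *+ _); apply: eq_card => s; rewrite !inE.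
Qed.

(* Row operations replace the monomials of the Vandermonde matrix by any
   monic polynomials of the same degrees. *)
Lemma det_monic n (x : 'rV[CC R]_n) (p : nat -> {poly CC R}) :
  (forall l, p l \is monic) -> (forall l, size (p l) = l.+1) ->
  \det (Vandermonde n x) = \det (\matrix_(l < n, j < n) (p l).[x 0 j]).
Proof.
move=> pm ps; pose A := \matrix_(l < n, k < n) (p l)`_k.
have -> : \matrix_(l < n, j < n) (p l).[x 0 j] = A *m Vandermonde n x.
  apply/matrixP => l j; rewrite !mxE (@horner_coef_wide _ n) ?ps //.
  by apply: eq_bigr => k _; rewrite !mxE.
rewrite det_mulmx det_trig; last first.
  by apply/is_trig_mxP => l k lk; rewrite mxE nth_default // ps.
rewrite big1 ?mul1r // => l _; rewrite mxE.
by have /monicP := pm l; rewrite lead_coefE ps.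
Qed.

Lemma pair_product_le e (Q : {poly CC R}) m (t M : R) (s : seq (CC R)) :
  (0 < m)%N -> Q \is monic -> size Q = m.+1 ->
  (forall z, e z -> cmod Q.[z] <= t) -> (forall z, e z -> cmod z <= M) ->
  (forall x, x \in s -> e x) ->
  pair_product s <= (size s)`!%:R * \prod_(l < size s) (t ^+ (l %/ m) * M ^+ (l %% m)).
Proof.
move=> m0 Qm Qs Qt eM es; rewrite pair_product_det.
rewrite (@det_monic _ _ (fun l => Q ^+ (l %/ m) * 'X^(l %% m))); first last.
- move=> l; rewrite size_Mmonic ?monicXn ?monic_neq0 ?monic_exp // size_polyXn.
  rewrite addnS /= -[size _]prednK ?size_poly_gt0 ?monic_neq0 ?monic_exp //.
  by rewrite size_exp Qs /= mulnC addSn -divn_eq.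
- by move=> l; rewrite monicMl ?monicXn // monic_exp.
apply: det_le_fact => l j; rewrite !mxE hornerM horner_exp hornerXn cmodM !cmodX.
have ej : e s`_j by apply: es; exact: mem_nth.
by rewrite ler_pM ?exprn_ge0 ?cmod_ge0 // lerXn2r ?nnegrE ?cmod_ge0 ?Qt ?eM //
  (le_trans (cmod_ge0 _) (Qt _ ej), le_trans (cmod_ge0 _) (eM _ ej)).
Qed.

Lemma pair_product_gt0 (s : seq (CC R)) : uniq s -> 0 < pair_product s.
Proof.
elim: s => [|x s IH] //= /andP[xs us]; rewrite mulr_gt0 ?IH //.
rewrite big_seq; apply: prodr_gt0 => y ys; rewrite cmod_gt0 subr_eq0.
by apply: contraNneq xs => <-.
Qed.

(** Coinciding points make the logarithm of the product meaningless; the diagonal value of the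
    kernel settles that case. *)
Lemma pair_energy_dup c (s : seq (CC R)) : ~~ uniq s -> pair_energy c s = +oo%E.
Proof.
elim: s => [|x s IH] //=; rewrite negb_and negbK => /orP[xs|/IH ->]; last first.
  rewrite addey // -ltNye (lt_le_trans (ltNyr 0)) //.
  by apply: sume_ge0 => y _; exact: shift_kernel_ge0.
rewrite (big_rem x) //= (_ : shift_kernel c (x, x) = +oo%E); last first.
  by rewrite /shift_kernel /log_kernel /= subrr cmod0 lexx /= addye // max_r // leey.
rewrite -addeA addye // -ltNye (lt_le_trans (ltNyr 0)) //.
rewrite adde_ge0 ?pair_energy_ge0 //.
by apply: sume_ge0 => y _; exact: shift_kernel_ge0.
Qed.

Lemma shift_kernel_ge (c : R) z w : z != w ->
  ((c - ln (cmod (z - w)))%:E <= shift_kernel c (z, w))%E.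
Proof.
move=> zw; rewrite /shift_kernel le_max; apply/orP; right.
rewrite /log_kernel lne_EFin; last by rewrite cmod_gt0 subr_eq0.
by rewrite -EFinN -EFinD addrC.
Qed.

Lemma pair_energy_ge (c : R) (s : seq (CC R)) : uniq s ->
  (('C(size s, 2)%:R * c - ln (pair_product s))%:E <= pair_energy c s)%E.
Proof.
elim: s => [|x s IH]; first by rewrite /= bin0n mul0r ln1 subr0.
move=> /[dup] uxs /= /andP[xs us].
have p0 : 0 < \prod_(y <- s) cmod (y - x).
  rewrite big_seq; apply: prodr_gt0 => y ys; rewrite cmod_gt0 subr_eq0.
  by apply: contraNneq xs => <-.
rewrite lnM ?posrE ?pair_product_gt0 //.
have -> : 'C((size s).+1, 2)%:R * c - (ln (\prod_(y <- s) cmod (y - x)) + ln (pair_product s))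
  = ((size s)%:R * c - ln (\prod_(y <- s) cmod (y - x))) +
    ('C(size s, 2)%:R * c - ln (pair_product s)).
  by rewrite binS bin1 natrD; ring.
rewrite EFinD leeD ?IH //.
elim: s xs us {IH uxs} p0 => [|y s IH] /=.
  by rewrite !big_nil mul0r ln1 subr0.
rewrite !inE negb_or => /andP[xy xs] /andP[ys us].
have p0 : 0 < \prod_(y <- s) cmod (y - x).
  rewrite big_seq; apply: prodr_gt0 => y' y's; rewrite cmod_gt0 subr_eq0.
  by apply: contraNneq xs => <-.
have yx : 0 < cmod (y - x) by rewrite cmod_gt0 subr_eq0 eq_sym.
rewrite !big_cons lnM ?posrE // => _.
have -> : (size s).+1%:R * c - (ln (cmod (y - x)) + ln (\prod_(y <- s) cmod (y - x)))
  = (c - ln (cmod (y - x))) + ((size s)%:R * c - ln (\prod_(y <- s) cmod (y - x))).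
  by rewrite -natr1; ring.
by rewrite EFinD leeD ?IH ?shift_kernel_ge // eq_sym.
Qed.

End Vandermonde.

(** * Capacity bounded above by norms of monic polynomials *)

Section CapacityUpper.
Variable R : realType.
Implicit Types (z w b : CC R) (r : R) (e : set (CC R)).

Lemma ln_fact_le n : ln (n`!%:R : R) <= n%:R * ln n%:R.
Proof.
case: n => [|n]; first by rewrite fact0 ln1 mul0r.
have H : (n.+1`! <= n.+1 ^ n.+1)%N.
  elim: n => // n IH; rewrite factS [leqRHS]expnS leq_mul2l /=.
  by rewrite (leq_trans IH) // leq_exp2r.
rewrite mulr_natl -lnXn ?ltr0n // ler_ln ?posrE ?ltr0n ?fact_gt0 ?exprn_gt0 ?ltr0n //.
by rewrite -natrX ler_nat.
Qed.

(** Indices are grouped into [q] blocks of length [m]. Block number j contributes t^(jm) exactly,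
    and at most M^(m m) since [1 <= M]. *)
Lemma prod_divn_modn (t M : R) q m : (0 < m)%N -> 0 < t -> 1 <= M ->
  \prod_(l < q * m) (t ^+ (l %/ m) * M ^+ (l %% m)) <=
  t ^+ ('C(q, 2) * m) * M ^+ (q * m * m).
Proof.
move=> m0 t0 M1; have M0 : 0 < M by rewrite (lt_le_trans ltr01).
rewrite -(big_mkord xpredT (fun l => t ^+ (l %/ m) * M ^+ (l %% m))).
elim: q => [|q IH]; first by rewrite !mul0n big_geq // !expr0 mulr1.
rewrite mulSn addnC (@big_cat_nat _ _ _ (q * m)) ?leq_addr //=.
rewrite binS bin1 mulnDl exprD !mulnDl [in leRHS]exprD.
rewrite mulrACA ler_pM ?prodr_ge0 //.
- by move=> l _; rewrite mulr_ge0 // exprn_ge0 // ltW.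
- by move=> l _; rewrite mulr_ge0 // exprn_ge0 // ltW.
rewrite -{1}[(q * m)%N]add0n big_addn addnC addnK big_mkord.
apply: (@le_trans _ _ (\prod_(i < m) (t ^+ q * M ^+ m))).
  apply: ler_prod => i _; rewrite addnC divnMDl // modnMDl divn_small // addn0.
  rewrite mulr_ge0 ?exprn_ge0 ?(ltW t0) ?(ltW M0) //=.
  rewrite ler_wpM2l ?exprn_ge0 ?(ltW t0) //.
  by rewrite modn_small // ler_weXn2l // ltnW.
by rewrite prodr_const card_ord exprMn -!exprM.
Qed.

Lemma quadratic_linear_bound (a C : R) :
  (forall k, (0 < k)%N -> k%:R ^+ 2 * a <= 4 * k%:R + C) -> a <= 0.
Proof.
move=> H; rewrite leNgt; apply/negP => a0.
pose k := (Num.truncn ((4 + `|C|) / a)).+1.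
have ka : (4 + `|C|) / a < k%:R by rewrite truncnS_gt.
have k1 : 1 <= k%:R :> R by rewrite ler1n.
have := H k isT; move: ka; rewrite ltr_pdivrMr // => ka.
have := ler_norm C; have := normr_ge0 C; nra.
Qed.

Lemma log_energy_ge e (Q : {poly CC R}) m (mu : probability (borelCC R) R) :
  compact e -> ~ finite_set e -> (0 < m)%N -> Q \is monic -> size Q = m.+1 ->
  mu e = 1%E -> ((- (ln (sup_norm e (horner Q)) / m%:R))%:E <= log_energy mu)%E.
Proof.
move=> ce einf m0 Qm Qs mue.
set t := sup_norm e (horner Q).
have t0 : 0 < t by apply: infinite_sup_norm_gt0 => //; rewrite monic_neq0.
have [M' M'0 HM'] := compact_bound 'X ce.
pose M := M' + 1.
have eM z : e z -> cmod z <= M.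
  by move=> /HM'; rewrite hornerX => H; rewrite (le_trans H) // lerDl.
have M1 : 1 <= M by rewrite lerDr ltW.
pose c := ln (2 * M).
have M20 : 0 < 2 * M by rewrite mulr_gt0 // (lt_le_trans ltr01).
have c0 : 0 <= c by apply: ln_ge0; lra.
have ec z w : e z -> e w -> cmod (z - w) <= expR c.
  move=> /eM zM /eM wM; rewrite lnK ?posrE //.
  by have := cmodD z (- w); rewrite cmodN; lra.
have me : measurable (e : set (borelCC R)).
  by apply: closed_measurableCC; exact: compact_closedCC.
rewrite (log_energy_shift me mue c0 ec).
have : (0 <= \int[mu]_z potential mu c z)%E.
  by apply: integral_ge0 => z _; exact: potential_ge0.
have := @pair_energy_min _ mu e c me mue.
case: (\int[mu]_z _)%E => [r| |] //= Hr r0; last by rewrite addye // leey.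
rewrite -EFinD lee_fin -/t.
rewrite lerNl opprB.
suff : (c - r) * m%:R - ln t <= 0 by rewrite subr_le0 ler_pdivlMr // ltr0n.
(* Collects all that does not grow with [k]; the term [4 * k%:R] comes from 2 ln N. *)
pose B := 2 * `|ln m%:R| + 2 * m%:R * ln M + `|c - r| + `|ln t|.
apply: (@quadratic_linear_bound _ B) => k k0.
(* With a square number of blocks, ln N = 2 ln k + ln m is bounded by the inequality ln k <= k
   alone, and is still negligible against q = k^2. *)
pose q := (k * k)%N; pose N := (q * m)%N.
have q0 : (0 < q)%N by rewrite muln_gt0 k0.
have N0 : (0 < N)%N by rewrite muln_gt0 q0.
have NR : (0 : R) < N%:R by rewrite ltr0n.
have {Hr} Hr : 'C(N, 2)%:R * c - ln (N`!%:R * (t ^+ ('C(q, 2) * m) * M ^+ (N * m)))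
    <= 'C(N, 2)%:R * r.
  rewrite -lee_fin [leRHS]EFinM; apply: Hr => s sN es.
  have [us|/pair_energy_dup ->] := boolP (uniq s); last by rewrite leey.
  apply: le_trans (pair_energy_ge c us); rewrite lee_fin sN lerD2l lerN2.
  have M0 : 0 < M by rewrite (lt_le_trans ltr01).
  rewrite ler_ln ?posrE ?pair_product_gt0 //; last first.
    by rewrite !mulr_gt0 ?exprn_gt0 // ltr0n fact_gt0.
  have Qt z : e z -> cmod Q.[z] <= t by exact: sup_norm_ub.
  apply: le_trans (pair_product_le m0 Qm Qs Qt eM es) _.
  by rewrite sN ler_wpM2l // prod_divn_modn.
have M0 : 0 < M by rewrite (lt_le_trans ltr01).
move: Hr; rewrite !lnM ?posrE ?mulr_gt0 ?exprn_gt0 ?ltr0n ?fact_gt0 //.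
rewrite !lnXn // -![ln _ *+ _]mulr_natl.
have b2 n : 'C(n, 2)%:R = n%:R * (n%:R - 1) / 2 :> R.
  have : ('C(n, 2) * 2)%N%:R = (n * n.-1)%N%:R :> R.
    by rewrite bin2 -[in RHS](odd_double_half (n * n.-1)) muln2 oddM;
      case: n => //= n; rewrite andNb.
  rewrite !natrM => /(congr1 (fun x => x / 2)); rewrite mulfK // => ->.
  by case: n => [|n]; rewrite ?mul0r //= -natr1 addrK.
rewrite !natrM !b2.
have Hf := ln_fact_le N.
have lN : ln N%:R <= 2 * k%:R + `|ln m%:R| :> R.
  rewrite !natrM !lnM ?posrE ?mulr_gt0 ?ltr0n //.
  have : ln k%:R <= k%:R :> R.
    by apply: ltW; apply: ln_sublinear; rewrite ltr0n.
  have := ler_norm (ln m%:R : R); lra.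
have qE : q%:R = k%:R ^+ 2 :> R by rewrite natrM expr2.
have NE : N%:R = q%:R * m%:R :> R by rewrite natrM.
set x := N%:R in Hf lN NE NR *; set L := ln N`!%:R in Hf *.
set y := q%:R in qE NE *; set mm := m%:R in NE lN *.
move=> H.
(* The main inequality divided by N / 2, after ln N! has been replaced by N ln N. *)
have H1 : (x - 1) * (c - r) <= 2 * ln x + (y - 1) * ln t + 2 * mm * ln M.
  have : x * ((x - 1) * (c - r)) <= x * (2 * ln x + (y - 1) * ln t + 2 * mm * ln M).
    rewrite NE; rewrite NE -expr2 -qE in H; rewrite NE in Hf; lra.
  by rewrite ler_pM2l.
rewrite -qE.
have := ler_norm (c - r); have := ler_norm (- ln t); rewrite normrN => h1 h2.
rewrite NE in H1 lN; rewrite /B -/mm.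
lra.
Qed.

Lemma min_energy_ge e (Q : {poly CC R}) m : compact e ->
  ~ finite_set e -> (0 < m)%N -> Q \is monic -> size Q = m.+1 ->
  (- min_energy e <= (ln (sup_norm e (horner Q)) / m%:R)%:E)%E.
Proof.
move=> ce einf m0 Qm Qs; rewrite leeNl -EFinN; apply: le_ereal_inf_tmp => _ [mu mue <-].
exact: log_energy_ge.
Qed.

(** The polynomial X already bounds the energies from below, so [fine] in [capacity] loses
    nothing. *)
Lemma expeR_min_energy_fin e : compact e -> ~ finite_set e ->
  expeR (- min_energy e) \is a fin_num.
Proof.
move=> ce einf; rewrite ge0_fin_numE ?expeR_ge0 //.
have := min_energy_ge ce einf (ltnSn 0) (monicX _) (size_polyX _).
by rewrite -lee_expeR /= => /le_lt_trans; apply; rewrite ltry.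
Qed.

Lemma capacity_ge0 e : 0 <= capacity e.
Proof. by rewrite fine_ge0 // expeR_ge0. Qed.

Lemma capacity_le e (Q : {poly CC R}) m : compact e ->
  ~ finite_set e -> (0 < m)%N -> Q \is monic -> size Q = m.+1 ->
  capacity e ^+ m <= sup_norm e (horner Q).
Proof.
move=> ce einf m0 Qm Qs.
set t := sup_norm e (horner Q).
have t0 : 0 < t by apply: infinite_sup_norm_gt0 => //; rewrite monic_neq0.
have C1 : capacity e <= expR (ln t / m%:R).
  rewrite -lee_fin fineK ?expeR_min_energy_fin //.
  by rewrite -[leRHS]/(expeR (ln t / m%:R)%:E) lee_expeR min_energy_ge.
apply: le_trans (_ : expR (ln t / m%:R) ^+ m <= _).
  by rewrite lerXn2r ?nnegrE ?capacity_ge0 // expR_ge0.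
by rewrite -expRM_natl mulrC divfK ?lnK // pnatr_eq0 -lt0n.
Qed.

End CapacityUpper.

(** * Measurable choice of the roots of a polynomial *)

Section ComplexMeasurable.
Variable R : realType.
Context d (X : measurableType d).

Lemma bigcup_countable_measurable (I : countType) (F : I -> set X) :
  (forall i, measurable (F i)) -> measurable (\bigcup_i F i).
Proof.
move=> mF; rewrite (_ : \bigcup_i F i =
    \bigcup_n (if unpickle n is Some i then F i else set0)).
  by apply: bigcupT_measurable => n; case: unpickle.
rewrite eqEsubset; split=> x [i _ Fx].
  by exists (pickle i) => //; rewrite pickleK.
by move: Fx; case: unpickle => // j Fj; exists j.
Qed.

Lemma measurable_lt_fun (f : X -> R) c : measurable_fun setT f ->
  measurable [set x | f x < c].
Proof.
move=> mf; rewrite -[mkset _]setTI (_ : mkset _ = f @^-1` `]-oo, c[%classic).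
  exact: mf.
by apply/seteqP; split=> x; rewrite /= in_itv.
Qed.

Lemma measurable_fun_le_sets (f : X -> R) :
  (forall c, measurable [set x | f x <= c]) -> measurable_fun setT f.
Proof.
move=> H; apply: (measurability _ (RGenOInfty.measurableE R)).
move=> _ [_ [c ->] <-]; rewrite setTI.
rewrite (_ : _ @^-1` _ = ~` [set x | f x <= c]); first exact: measurableC.
apply/seteqP; split=> x /=; rewrite in_itv /= andbT ltNge => /negP //.
Qed.

(** Coordinatewise measurability passes through ring operations by the real case;
    [cmeasurable_measurable] turns it into measurability for [borelCC]. *)
Definition cmeasurable (f : X -> CC R) : Prop :=
  measurable_fun setT (fun x => cRe (f x)) /\
  measurable_fun setT (fun x => cIm (f x)).

Lemma cmeasurable_cst (c : CC R) : cmeasurable (fun=> c).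
Proof. by split; exact: measurable_cst. Qed.

Lemma cmeasurableD f g : cmeasurable f -> cmeasurable g ->
  cmeasurable (fun x => f x + g x).
Proof.
move=> [f1 f2] [g1 g2]; split.
  by under eq_fun do rewrite cReD; exact: measurable_funD.
by under eq_fun do rewrite cImD; exact: measurable_funD.
Qed.

Lemma cmeasurableM f g : cmeasurable f -> cmeasurable g ->
  cmeasurable (fun x => f x * g x).
Proof.
move=> [f1 f2] [g1 g2]; split.
  under eq_fun do rewrite cReM.
  by apply: measurable_funB; exact: measurable_funM.
under eq_fun do rewrite cImM.
by apply: measurable_funD; exact: measurable_funM.
Qed.

Lemma cmeasurableX f n : cmeasurable f -> cmeasurable (fun x => f x ^+ n).
Proof.
move=> mf; elim: n => [|n IH]; first exact: cmeasurable_cst.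
by under eq_fun do rewrite exprS; exact: cmeasurableM.
Qed.

Lemma cmeasurable_sum n (f : 'I_n -> X -> CC R) :
  (forall i, cmeasurable (f i)) -> cmeasurable (fun x => \sum_(i < n) f i x).
Proof.
elim: n f => [|n IH] f mf.
  by under eq_fun do rewrite big_ord0; exact: cmeasurable_cst.
under eq_fun do rewrite big_ord_recl.
by apply: cmeasurableD => //; apply: IH.
Qed.

(** An open set is the countable union of the discs it contains with rational centre and radius the
    inverse of a positive integer. *)
Lemma cmeasurable_measurable (f : X -> CC R) : cmeasurable f ->
  measurable_fun setT (f : X -> borelCC R).
Proof.
move=> [fRe fIm]; apply: (@measurability _ _ X (borelCC R) setT f (@open (CC R))) => //.
move=> _ [U /openCC oU <-]; rewrite setTI.
pose nr (k : rat * rat * nat) (z : CC R) :=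
  cmod (z - mkC (ratr k.1.1) (ratr k.1.2)) < k.2.+1%:R^-1.
rewrite (_ : f @^-1` U = \bigcup_k [set x | nr k (f x) /\ nr k `<=` U]).
  apply: bigcup_countable_measurable => k.
  have [kU|nkU] := pselect (nr k `<=` U); last first.
    rewrite (_ : mkset _ = set0) //; last by apply/seteqP; split=> // x [].
  rewrite (_ : mkset _ = [set x | nr k (f x)]); last first.
    by apply/seteqP; split=> x // [].
  apply: measurable_lt_fun; apply: measurable_cmod_ReIm.
    by under eq_fun do rewrite cReB; exact: measurable_funB.
  by under eq_fun do rewrite cImB; exact: measurable_funB.
apply/seteqP; split=> [x /= Ufx|x [k _ [kx kU]]]; last exact: kU.
have [r r0 sub] := oU _ Ufx.
have [N Nr] : exists N : nat, N.+1%:R^-1 < r / 2.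
  exists (Num.truncn (r / 2)^-1); rewrite invf_plt ?posrE ?divr_gt0 //.
  by rewrite truncnS_gt.
have N0 : (0 : R) < N.+1%:R^-1 / 2 by rewrite divr_gt0 // invr_gt0 ltr0n.
have ratN (u : R) : exists q : rat, u < ratr q < u + N.+1%:R^-1 / 2.
  have /rat_in_itvoo[q] : u < u + N.+1%:R^-1 / 2 by rewrite ltrDl.
  by rewrite in_itv /= => uq; exists q.
have [q1 /andP[a1 a2]] := ratN (cRe (f x)).
have [q2 /andP[b1 b2]] := ratN (cIm (f x)).
have fq : cmod (f x - mkC (ratr q1) (ratr q2)) < N.+1%:R^-1.
  rewrite (le_lt_trans (cmod_leD _)) // cReB cImB.
  rewrite -[cRe (mkC _ _)]/(ratr q1) -[cIm (mkC _ _)]/(ratr q2).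
  rewrite (distrC (cRe _)) (distrC (cIm _)) !gtr0_norm ?subr_gt0 //.
  rewrite (_ : N.+1%:R^-1 = N.+1%:R^-1 / 2 + N.+1%:R^-1 / 2); last by field.
  by rewrite ltrD // ltrBlDl.
exists (q1, q2, N) => //; split=> // z zk; apply: sub.
rewrite -(subrK (mkC (ratr q1) (ratr q2)) z) -addrA (le_lt_trans (cmodD _ _)) //.
have {}zk : cmod (z - mkC (ratr q1) (ratr q2)) < N.+1%:R^-1 := zk.
rewrite (cmod_distC _ (f x)); apply: (lt_trans (ltrD zk fq)).
by rewrite (splitr r) ltrD.
Qed.

End ComplexMeasurable.

Section MeasurableRoots.
Variable R : realType.

Lemma monic_roots (p : {poly CC R}) : p \is monic ->
  exists s : seq (CC R), p = \prod_(w <- s) ('X - w%:P).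
Proof.
move=> pm; have [s ps] := closed_field_poly_normal p; exists s.
by rewrite {1}ps (monicP pm) scale1r.
Qed.

(** If no root lies in the closed set [S], each linear factor is bounded below on [S] by the
    distance of its root to [S], hence so is the product. *)
Lemma root_in_closed (p : {poly CC R}) (S : set (CC R)) : p \is monic ->
  closed S -> (forall eps : R, 0 < eps -> exists2 q, S q & cmod p.[q] < eps) ->
  exists2 w, S w & root p w.
Proof.
move=> pm clS H; have [s ps] := monic_roots pm; apply: contrapT => nS.
have [d d0 Hd] : exists2 d : R, 0 < d & forall q, S q -> d <= cmod p.[q].
  have : forall w, w \in s -> ~ S w.
    by move=> w ws Sw; apply: nS; exists w => //; rewrite ps root_prod_XsubC.
  rewrite ps; elim: (s) => [|w s' IH] sS.
    by exists 1 => // q _; rewrite big_nil hornerC cmod1.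
  have [|d1 d10 H1] := IH; first by move=> u us; apply: sS; rewrite inE us orbT.
  have [|r r0 sub] := (openCC _).1 (closed_openC clS) w.
    by apply: sS; rewrite inE eqxx.
  exists (r * d1) => [|q Sq]; first by rewrite mulr_gt0.
  rewrite big_cons hornerM cmodM hornerXsubC.
  rewrite ler_pM ?H1 ?(ltW r0) ?(ltW d10) // leNgt; apply/negP => /sub; exact.
by have [q Sq] := H d d0; rewrite ltNge Hd.
Qed.

Lemma root_near (p : {poly CC R}) w : root p w -> forall eps : R, 0 < eps ->
  exists2 r, 0 < r & forall q, cmod (q - w) < r -> cmod p.[q] < eps.
Proof.
move=> /rootP pw eps eps0.
have [r r0 H] := continuous_cmod_fun (@horner_cont _ p w) eps0.
by exists r => // q /H; rewrite pw subr0.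
Qed.

Definition lex_le (z w : CC R) : Prop :=
  cRe z < cRe w \/ cRe z = cRe w /\ cIm z <= cIm w.

Lemma lex_min (s : seq (CC R)) : s != [::] ->
  exists2 w, w \in s & forall u, u \in s -> lex_le w u.
Proof.
elim: s => // x [|y s] IH _.
  by exists x; rewrite ?inE // => u; rewrite inE => /eqP ->; right.
have [//|w ws Hw] := IH.
have [xw|wx] : lex_le x w \/ lex_le w x.
  rewrite /lex_le; have [|?|->] := ltgtP (cRe x) (cRe w); [by left; left|by right; left|].
  by case: (leP (cIm x) (cIm w)) => [?|/ltW ?]; [left; right|right; right].
  exists x; first by rewrite inE eqxx.
  move=> u; rewrite inE => /predU1P[->|us]; first by right.
  have := Hw u us; move: xw; rewrite /lex_le => -[xw|[xw1 xw2]] [wu|[wu1 wu2]].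
  - by left; exact: lt_trans wu.
  - by left; rewrite -wu1.
  - by left; rewrite xw1.
  - by right; rewrite xw1 wu1; split=> //; exact: le_trans wu2.
exists w; first by rewrite inE ws orbT.
by move=> u; rewrite inE => /predU1P[->|/Hw].
Qed.

Lemma rat_below (u r : R) : 0 < r -> exists q : rat, u - r < ratr q < u.
Proof.
move=> r0; have /rat_in_itvoo[q] : u - r < u by rewrite ltrBlDr ltrDl.
by rewrite in_itv /= => uq; exists q.
Qed.

Context d (X : measurableType d).
Implicit Types p : X -> {poly CC R}.

Lemma cmeasurable_horner p n (f : X -> CC R) :
  (forall x, (size (p x) <= n)%N) -> (forall k, cmeasurable (fun x => (p x)`_k)) ->
  cmeasurable f -> cmeasurable (fun x => (p x).[f x]).
Proof.
move=> ps pm fm; under eq_fun => x do rewrite (horner_coef_wide (f x) (ps x)).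
apply: cmeasurable_sum => i; apply: cmeasurableM => //; exact: cmeasurableX.
Qed.

Lemma measurable_forall_exists (I : countType) (F : I -> X -> R) :
  (forall i, measurable_fun setT (F i)) ->
  measurable [set x | forall eps : R, 0 < eps -> exists i, F i x < eps].
Proof.
move=> mF; rewrite (_ : mkset _ =
    \bigcap_n \bigcup_i [set x | F i x < n.+1%:R^-1]).
  apply: bigcapT_measurable => n; apply: bigcup_countable_measurable => i.
  exact: measurable_lt_fun.
apply/seteqP; split=> x /= H.
  move=> n _; have [|i Fi] := H n.+1%:R^-1; first by rewrite invr_gt0 ltr0n.
  by exists i.
move=> eps eps0; have [i _ /= Fi] := H (Num.truncn eps^-1) Logic.I.
exists i; apply: lt_trans Fi _; rewrite invf_plt ?posrE //.
by rewrite truncnS_gt.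
Qed.

(* The lexicographically least root: its real part is at most [c] if and only
   if [p x] takes arbitrarily small values at rational points of the half
   plane [Re <= c]; its imaginary part is then handled on a vertical line. *)
Lemma measurable_root p n : (forall x, p x \is monic) ->
  (forall x, size (p x) = n.+2) -> (forall k, cmeasurable (fun x => (p x)`_k)) ->
  exists r : X -> CC R, cmeasurable r /\ forall x, root (p x) (r x).
Proof.
move=> pm ps pc.
have H x : exists w, root (p x) w /\ forall u, root (p x) u -> lex_le w u.
  have [s sE] := monic_roots (pm x).
  have s0 : s != [::].
    by apply/eqP => s0; have := ps x; rewrite sE s0 big_nil size_poly1.
  have [w ws Hw] := lex_min s0; exists w; rewrite sE root_prod_XsubC; split=> // u.
  by rewrite root_prod_XsubC; exact: Hw.
have [r Hr] := choice H.
have psn x : (size (p x) <= n.+2)%N by rewrite ps.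
have mval f : cmeasurable f -> measurable_fun setT (fun x => cmod (p x).[f x]).
  by move=> fm; have [] := cmeasurable_horner psn pc fm; exact: measurable_cmod_ReIm.
have mRe : measurable_fun setT (fun x => cRe (r x)).
  apply: measurable_fun_le_sets => c.
  (* Points outside the half plane get the value 1, which is never below [Num.min eps 1]. *)
  pose F (q : rat * rat) (x : X) : R :=
    if ratr q.1 <= c then cmod (p x).[mkC (ratr q.1) (ratr q.2)] else 1.
  rewrite (_ : mkset _ = [set x | forall eps : R, 0 < eps -> exists q, F q x < Num.min eps 1]).
    rewrite (_ : mkset _ = [set x | forall eps : R, 0 < eps -> exists q, F q x < eps]).
      apply: measurable_forall_exists => q; rewrite /F; case: (ratr q.1 <= c) => //.
      by apply: mval; exact: cmeasurable_cst.
    apply/seteqP; split=> x Hx eps eps0.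
      by have [q] := Hx eps eps0; rewrite lt_min => /andP[Fq _]; exists q.
    by apply: Hx; rewrite lt_min eps0 ltr01.
  apply/seteqP; split=> x /= Hx.
    move=> eps eps0; have e1 : 0 < Num.min eps 1 by rewrite lt_min eps0 ltr01.
    have [rd rd0 Hrd] := root_near (Hr x).1 e1.
    have rd2 : 0 < rd / 2 by rewrite divr_gt0.
    (* Approximating the root from the left keeps the rational point in the half plane. *)
    have [q1 /andP[a1 a2]] := rat_below (cRe (r x)) rd2.
    have [q2 /andP[b1 b2]] := rat_below (cIm (r x)) rd2.
    exists (q1, q2); rewrite /F /= ifT; last by rewrite (le_trans (ltW a2)).
    apply: Hrd; rewrite (le_lt_trans (cmod_leD _)) // cReB cImB.
    rewrite -[cRe (mkC _ _)]/(ratr q1) -[cIm (mkC _ _)]/(ratr q2).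
    rewrite !ltr0_norm ?subr_lt0 // (splitr rd) ltrD //; lra.
  have [w /= wc pw] : exists2 w, [set w : CC R | cRe w <= c] w & root (p x) w.
    apply: (root_in_closed (pm x)).
      rewrite (_ : mkset _ = (@cRe R) @^-1` [set y : R | y <= c]) //.
      by apply: closed_comp => [z _|]; [exact: cRe_cont|exact: closed_le].
    move=> eps eps0; have [q] := Hx eps eps0.
    rewrite /F lt_min; case: ifP => [qc /andP[Fq _]|_]; last by rewrite ltxx andbF.
    by exists (mkC (ratr q.1) (ratr q.2)).
  have [rw|[rw _]] := (Hr x).2 w pw; last by rewrite rw.
  by rewrite (le_trans (ltW rw)).
have mIm : measurable_fun setT (fun x => cIm (r x)).
  apply: measurable_fun_le_sets => c.
  pose F (q : rat) (x : X) : R :=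
    if ratr q <= c then cmod (p x).[mkC (cRe (r x)) (ratr q)] else 1.
  rewrite (_ : mkset _ = [set x | forall eps : R, 0 < eps -> exists q, F q x < Num.min eps 1]).
    rewrite (_ : mkset _ = [set x | forall eps : R, 0 < eps -> exists q, F q x < eps]).
      apply: measurable_forall_exists => q; rewrite /F; case: (ratr q <= c) => //.
      by apply: mval; split => //; exact: measurable_cst.
    apply/seteqP; split=> x Hx eps eps0.
      by have [q] := Hx eps eps0; rewrite lt_min => /andP[Fq _]; exists q.
    by apply: Hx; rewrite lt_min eps0 ltr01.
  apply/seteqP; split=> x /= Hx.
    move=> eps eps0; have e1 : 0 < Num.min eps 1 by rewrite lt_min eps0 ltr01.
    have [rd rd0 Hrd] := root_near (Hr x).1 e1.
    have [q /andP[b1 b2]] := rat_below (cIm (r x)) rd0.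
    exists q; rewrite /F /= ifT; last by rewrite (le_trans (ltW b2)).
    apply: Hrd; rewrite (le_lt_trans (cmod_leD _)) // cReB cImB.
    rewrite -[cRe (mkC _ _)]/(cRe (r x)) -[cIm (mkC _ _)]/(ratr q).
    by rewrite subrr normr0 add0r ltr0_norm ?subr_lt0 //; lra.
  have [w /= [wx wc] pw] : exists2 w,
      [set w : CC R | cRe w = cRe (r x) /\ cIm w <= c] w & root (p x) w.
    apply: (root_in_closed (pm x)).
      rewrite (_ : mkset _ = (@cRe R) @^-1` [set y : R | y = cRe (r x)] `&`
        (@cIm R) @^-1` [set y : R | y <= c]) //.
      apply: closedI.
        by apply: closed_comp => [z _|]; [exact: cRe_cont|exact: closed_eq].
      by apply: closed_comp => [z _|]; [exact: cIm_cont|exact: closed_le].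
    move=> eps eps0; have [q] := Hx eps eps0.
    rewrite /F lt_min; case: ifP => [qc /andP[Fq _]|_]; last by rewrite ltxx andbF.
    by exists (mkC (cRe (r x)) (ratr q)).
  have [rw|[_ rw]] := (Hr x).2 w pw; first by rewrite wx ltxx in rw.
  exact: le_trans rw wc.
by exists r; split=> [|x]; [split|exact: (Hr x).1].
Qed.

(** One measurable root is divided out at a time. Synthetic division, run downwards from the top
    coefficient, shows that the quotient again has measurable coefficients. *)
Lemma measurable_roots n p : (forall x, p x \is monic) ->
  (forall x, size (p x) = n.+1) -> (forall k, cmeasurable (fun x => (p x)`_k)) ->
  exists r : nat -> X -> CC R, (forall i, cmeasurable (r i)) /\
    forall x, p x = \prod_(i < n) ('X - (r i x)%:P).
Proof.
elim: n p => [|n IH] p pm ps pc.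
  exists (fun _ _ => 0); split=> [i|x]; first exact: cmeasurable_cst.
  have := pm x; rewrite big_ord0 (size1_polyC (eq_leq (ps x))) => /monicP.
  by rewrite lead_coefC => ->.
have [r [rm Hr]] := measurable_root pm ps pc.
have Hg x : exists g, p x = g * ('X - (r x)%:P) by apply/factor_theorem; exact: Hr.
have [g gE] := choice Hg.
have gm x : g x \is monic.
  by have := pm x; rewrite gE monicMr // monicXsubC.
have gs x : size (g x) = n.+1.
  have := ps x; rewrite gE size_Mmonic ?monicXsubC ?monic_neq0 //.
  by rewrite size_XsubC addn2 => -[].
have rec x k : (g x)`_k = (p x)`_k.+1 + r x * (g x)`_k.+1.
  by rewrite gE mulrBr coefB coefMX /= coefMC mulrC subrK.
have gc k : cmeasurable (fun x => (g x)`_k).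
  (* Descending induction on [k]: [j] bounds its distance to the coefficients that vanish. *)
  have [j] : exists j, (n.+1 <= k + j)%N by exists n.+1; rewrite leq_addl.
  elim: j k => [|j IHj] k kj.
    rewrite addn0 in kj.
    rewrite (_ : (fun x => (g x)`_k) = fun=> 0); first exact: cmeasurable_cst.
    by apply/funext => x; rewrite nth_default // gs.
  under eq_fun => x do rewrite rec.
  apply: cmeasurableD => //; apply: cmeasurableM => //; apply: IHj.
  by rewrite addSnnS.
have [rs [rsm rsE]] := IH g gm gs gc.
exists (fun i => if i is j.+1 then rs j else r); split=> [[|i] //|x].
by rewrite big_ord_recl gE rsE mulrC.
Qed.

End MeasurableRoots.

(** * Logarithmic means over the unit circle *)

Section AffineSubstitution.
Variable R : realType.
Local Notation mu := (@lebesgue_measure R).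

Lemma continuous_integrable_itv (f : R -> R) (a b : R) : continuous f ->
  mu.-integrable `[a, b] (EFin \o f).
Proof.
move=> cf; apply: continuous_compact_integrable; first exact: segment_compact.
exact: continuous_subspaceT.
Qed.

Lemma affine_continuous (k c : R) : continuous (fun x : R => k * x + c).
Proof.
move=> x; apply: (@continuousD _ _ _ (fun x => k * x) (cst c)).
  exact: mulrl_continuous.
exact: cst_continuous.
Qed.

Lemma Rintegral_affine (G : R -> R) (k c a b : R) : continuous G -> 0 < k -> a <= b ->
  \int[mu]_(x in `[k * a + c, k * b + c]) G x =
  k * \int[mu]_(x in `[a, b]) G (k * x + c).
Proof.
move=> cG k0 ab; pose F x := k * x + c.
have dF (x : R) : is_derive x 1 F k.
  rewrite (_ : F = (k \*: id) + cst c); last by apply/funext.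
  by apply: is_derive_eq; rewrite addr0 /GRing.scale /= mulr1.
have F'E : derive1 F = cst k by apply/funext => x; rewrite derive1E; apply: derive_val.
have cF : continuous F by exact: affine_continuous.
rewrite -RintegralZl; last 2 first.
- by [].
- apply: continuous_integrable_itv => x.
  by apply: (@continuous_comp _ _ _ F G); [exact: cF|exact: cG].
rewrite /Rintegral; congr fine.
rewrite -/(F a) -/(F b) (@integration_by_substitution_increasing _ F G a b) //.
- by apply: eq_integral => x _; rewrite F'E /= mulrC.
- by move=> x y _ _ xy; rewrite /F ltrD2r ltr_pM2l.
- by rewrite F'E => x _; exact: cst_continuous.
- by rewrite F'E; exact: is_cvg_cst.
- by rewrite F'E; exact: is_cvg_cst.
- split=> [x _| |]; first exact: ex_derive.
    exact/cvg_at_right_filter/cF.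
  exact/cvg_at_left_filter/cF.
- exact: continuous_subspaceT.
Qed.

Lemma Rintegral_split (f : R -> R) (a b c : R) : continuous f -> a <= b -> b <= c ->
  \int[mu]_(x in `[a, c]) f x =
  \int[mu]_(x in `[a, b]) f x + \int[mu]_(x in `[b, c]) f x.
Proof.
move=> cf ab bc; have := @Rintegral_itvB R f (BLeft a) (BRight c) b
  (continuous_integrable_itv _ _ cf).
rewrite !bnd_simp => /(_ ab bc) /eqP; rewrite subr_eq => /eqP ->; rewrite addrC.
congr (_ + _); apply: Rintegral_itv_obnd_cbnd.
apply: integrableS (continuous_integrable_itv b c cf) => //.
by apply: subset_itvr; rewrite bnd_simp.
Qed.

(* The two halves of [0, 1] are mapped onto [0, 1] by doubling the angle. *)
Lemma Rintegral_doubling (f : R -> R) : continuous f ->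
  \int[mu]_(x in `[0, 1]) (f (2^-1 * x) + f (2^-1 * x + 2^-1)) =
  2 * \int[mu]_(x in `[0, 1]) f x.
Proof.
move=> cf; have caff k c : continuous (fun x : R => f (k * x + c)).
  move=> x; apply: (@continuous_comp _ _ _ (fun x => k * x + c) f); last exact: cf.
  exact: affine_continuous.
have cf0 : continuous (fun x : R => f (2^-1 * x)).
  by have := caff 2^-1 0; under eq_fun do rewrite addr0.
rewrite RintegralD //; last 2 first.
- exact: continuous_integrable_itv.
- exact: continuous_integrable_itv.
have half0 : (0 : R) < 2^-1 by rewrite invr_gt0.
rewrite (@Rintegral_split f 0 2^-1 1) ?ltW //; last by rewrite invf_lt1 ?ltr1n.
have := @Rintegral_affine f 2^-1 0 0 1 cf half0 ler01.
rewrite mulr0 mulr1 !addr0 => ->.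
have := @Rintegral_affine f 2^-1 2^-1 0 1 cf half0 ler01.
rewrite mulr0 mulr1 add0r (_ : 2^-1 + 2^-1 = 1 :> R) => [->|]; last by field.
rewrite mulrDr !mulrA divff ?mul1r //.
by congr (_ + _); apply: eq_Rintegral => x _; rewrite ?addr0.
Qed.

End AffineSubstitution.

(** * The mean of log |u - s| over the unit circle *)

Section Circle.
Variable R : realType.
Local Notation mu := (@lebesgue_measure R).

(** Normalised to period 1, so that Lebesgue measure on [0, 1] becomes the uniform probability on
    the circle. *)
Definition cis (x : R) : CC R := mkC (cos (pi *+ 2 * x)) (sin (pi *+ 2 * x)).

Lemma cmod_cis x : cmod (cis x) = 1.
Proof. by rewrite cmod_ReIm /cRe /cIm /= cos2Dsin2 sqrtr1. Qed.

Lemma cisD x y : cis (x + y) = cis x * cis y.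
Proof.
apply/eqP; rewrite eq_complex; apply/andP; split; apply/eqP.
  by rewrite -[LHS]/(cRe _) -[RHS]/(cRe _) cReM /cRe /cIm /= mulrDr cosD.
rewrite -[LHS]/(cIm _) -[RHS]/(cIm _) cImM /cRe /cIm /= mulrDr sinD.
by rewrite addrC.
Qed.

Lemma cis_half : cis 2^-1 = -1.
Proof.
rewrite /cis (_ : pi *+ 2 * 2^-1 = pi :> R); last by field.
rewrite cospi sinpi.
by apply/eqP; rewrite eq_complex /= oppr0 !eqxx.
Qed.

Lemma cis_continuous : continuous cis.
Proof.
move=> x A /nbhsCC[r r0 sub].
have ctrig (f : R -> R) : continuous f -> continuous (fun x => f (pi *+ 2 * x)).
  move=> cf y; apply: (@continuous_comp _ _ _ (fun y => pi *+ 2 * y) f); last exact: cf.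
  exact: mulrl_continuous.
have r2 : 0 < r / 2 by rewrite divr_gt0.
have /cvgrPdist_lt/(_ _ r2) H1 := ctrig _ (@continuous_cos R) x.
have /cvgrPdist_lt/(_ _ r2) H2 := ctrig _ (@continuous_sin R) x.
apply: filterS2 H1 H2 => y h1 h2; apply: sub.
rewrite (le_lt_trans (cmod_leD _)) // cReB cImB (splitr r) ltrD //.
  by rewrite distrC.
by rewrite distrC.
Qed.

Lemma dist_cis_continuous (w : CC R) : continuous (fun x => cmod (w - cis x)).
Proof.
move=> x; apply: (@continuous_comp _ _ _ cis (fun z => cmod (w - z))).
  exact: cis_continuous.
have := @cmod_horner_cont R (w%:P - 'X) (cis x).
by rewrite (_ : (fun z => cmod (w%:P - 'X).[z]) = fun z => cmod (w - z)) //;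
  apply/funext => z; rewrite !hornerE.
Qed.

Lemma dist_cis_ge (w : CC R) x : cmod w - 1 <= cmod (w - cis x).
Proof. by rewrite -(cmod_cis x) cmodB_ge. Qed.

Lemma log_dist_continuous (w : CC R) : 1 < cmod w ->
  continuous (fun x => ln (cmod (w - cis x))).
Proof.
move=> w1 x; apply: (@continuous_comp _ _ _ (fun x => cmod (w - cis x)) (@ln R)).
  exact: dist_cis_continuous.
apply: continuous_ln; rewrite (lt_le_trans _ (dist_cis_ge _ _)) //.
by rewrite subr_gt0.
Qed.

Definition log_mean (w : CC R) : R :=
  \int[mu]_(x in `[0, 1]) ln (cmod (w - cis x)).

(** Opposite points of the circle pair up: (w - s)(w + s) = w^2 - s^2. *)
Lemma log_mean_sqr w : 1 < cmod w -> log_mean (w ^+ 2) = 2 * log_mean w.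
Proof.
move=> w1; rewrite -Rintegral_doubling; last exact: log_dist_continuous.
apply: eq_Rintegral => x _.
have gt0 y : 0 < cmod (w - cis y).
  by rewrite (lt_le_trans _ (dist_cis_ge _ _)) // subr_gt0.
rewrite -lnM ?posrE // -cmodM; congr (ln (cmod _)).
rewrite cisD cis_half mulrN1 opprK -subr_sqr; congr (_ - _).
by rewrite expr2 -cisD; congr cis; field.
Qed.

Lemma lebesgue_measure01 : mu `[0, 1]%classic = 1%E.
Proof. by rewrite lebesgue_measure_itv /= lte01 oppr0 adde0. Qed.

Lemma log_mean_ge w : 1 < cmod w -> ln (cmod w - 1) <= log_mean w.
Proof.
move=> w1; have w0 : 0 < cmod w - 1 by rewrite subr_gt0.
rewrite -[leLHS](_ : \int[mu]_(x in `[0, 1]) ln (cmod w - 1) = _); last first.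
  rewrite Rintegral_cst // -[RHS]mulr1; congr (_ * _).
  exact: (congr1 fine lebesgue_measure01).
apply: le_Rintegral => //.
- by apply: continuous_integrable_itv => x; exact: cst_continuous.
- by apply: continuous_integrable_itv; exact: log_dist_continuous.
move=> x _; rewrite ler_ln ?posrE ?dist_cis_ge //.
exact: lt_le_trans (dist_cis_ge _ _).
Qed.

(** Iterated squaring multiplies the mean by 2^k and drives |w| beyond 2, where the trivial bound ln
    (|w| - 1) is nonnegative. *)
Lemma log_mean_ge0 w : 1 < cmod w -> 0 <= log_mean w.
Proof.
move=> w1; have w0 : 0 < cmod w by rewrite (lt_trans ltr01).
have pow k : 1 < cmod (w ^+ (2 ^ k)) /\ log_mean (w ^+ (2 ^ k)) = 2 ^+ k * log_mean w.
  elim: k => [|k [IH1 IH2]]; first by rewrite expn0 expr1 expr0 mul1r.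
  rewrite expnSr exprM; split; last by rewrite log_mean_sqr // IH2 exprS mulrA.
  by rewrite cmodX exprn_egt1.
have [|||k Hk] := @exprn_small R (cmod w)^-1 2^-1.
- by rewrite invr_ge0 ltW.
- by rewrite invf_lt1.
- by rewrite invr_gt0.
have [H1 H2] := pow k.
have w2 : 2 <= cmod (w ^+ (2 ^ k)).
  rewrite cmodX (@le_trans _ _ (cmod w ^+ k)) //.
    by move: Hk; rewrite exprVn ltf_pV2 ?posrE ?exprn_gt0 // => /ltW.
  by rewrite ler_eXn2l // ltnW // ltn_expl.
have := log_mean_ge H1; rewrite H2 => H3.
have : 0 <= 2 ^+ k * log_mean w.
  by apply: le_trans H3; apply: ln_ge0; lra.
by rewrite pmulr_rge0 // exprn_gt0.
Qed.

Lemma limn_einf_le (u : (\bar R)^nat) (c : \bar R) : (forall n, (u n <= c)%E) ->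
  (limn_einf u <= c)%E.
Proof.
move=> uc; rewrite limn_einf_lim; apply: lime_le; first exact: is_cvg_einfs.
apply: nearW => n; apply: le_trans (uc n).
by apply: ereal_inf_lbound; exists n => /=.
Qed.

(** Fatou's lemma along the points [w j] of modulus 1 + 1 / (j + 1) on the ray through [u]. These
    lie within 3 of the circle, so [ln 3 <= C] makes the integrands nonnegative. *)
Lemma circle_potential_le (u : CC R) (C : R) : cmod u = 1 -> ln 3 <= C ->
  (\int[mu]_(x in `[0%R, 1%R]) (C%:E - lne (cmod (u - cis x))%:E) <= C%:E)%E.
Proof.
move=> u1 C3.
pose rho (j : nat) : R := 1 + j.+1%:R^-1.
have j0 j : 0 < j.+1%:R^-1 :> R by rewrite invr_gt0 ltr0n.
have j1 j : j.+1%:R^-1 <= 1 :> R by rewrite invf_le1 ?ltr0n // ler1n.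
pose w j := rC (rho j) * u.
have cw j : cmod (w j) = rho j.
  by rewrite cmodM u1 mulr1 cmod_rC gtr0_norm // addr_gt0.
have w1 j : 1 < cmod (w j) by rewrite cw ltrDl.
have gt0 j x : 0 < cmod (w j - cis x).
  by rewrite (lt_le_trans _ (dist_cis_ge _ _)) // subr_gt0.
have clog j := log_dist_continuous (w1 j).
pose f j x : \bar R := (C - ln (cmod (w j - cis x)))%:E.
have f0 j x : (0 <= f j x)%E.
  rewrite lee_fin subr_ge0 (le_trans _ C3) // ler_ln ?posrE //.
  have := cmodD (w j) (- cis x); rewrite cmodN cmod_cis cw /rho.
  by have := j1 j; move: (_^-1) => y; lra.
have mf j : measurable_fun setT (f j).
  apply/measurable_EFinP; apply: measurable_funB => //.
  exact: continuous_measurable_fun.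
have wu j x : `|cmod (w j - cis x) - cmod (u - cis x)| <= j.+1%:R^-1.
  have E : cmod (w j - u) = j.+1%:R^-1.
    rewrite /w -[X in _ - X]mul1r -mulrBl cmodM u1 mulr1 /rho rCD rC1.
    by rewrite addrC addKr cmod_rC gtr0_norm.
  rewrite ler_norml; apply/andP; split.
    have := cmodB_ge (u - cis x) (u - w j).
    have -> : u - cis x - (u - w j) = w j - cis x by ring.
    by rewrite (cmod_distC u (w j)) E; move: (_^-1) => y; lra.
  have := cmodB_ge (w j - cis x) (w j - u).
  have -> : w j - cis x - (w j - u) = u - cis x by ring.
  by rewrite E; move: (_^-1) => y; lra.
have harm (eps : R) : 0 < eps -> exists N, forall j, (N <= j)%N -> j.+1%:R^-1 < eps.
  move=> eps0; exists (Num.truncn eps^-1) => j Nj.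
  rewrite invf_plt ?posrE // (lt_le_trans (truncnS_gt _)) // ler_nat.
  by rewrite ltnS.
have cvgf x : f ^~ x @ \oo --> (C%:E - lne (cmod (u - cis x))%:E)%E.
  have [ux|ux] := eqVneq (cmod (u - cis x)) 0.
    rewrite ux /lne lexx /=.
    apply/cvgeryP/cvgryPge => A.
    have [N HN] := harm (expR (C - A)) (expR_gt0 _).
    exists N => // j /= Nj; rewrite lerBrDr -lerBrDl -ler_expR lnK ?posrE //.
    have := wu j x; rewrite ux subr0 ger0_norm ?cmod_ge0 // => /le_trans; apply.
    exact/ltW/HN.
  have d0 : 0 < cmod (u - cis x) by rewrite lt_def ux cmod_ge0.
  rewrite lne_EFin //; apply/fine_cvgP; split; first exact: nearW.
  apply: (@cvgB _ _ _ _ _ (cst C)); first exact: cvg_cst.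
  apply: (@continuous_cvg _ _ _ _ _ _ (@ln R)); first exact: continuous_ln.
  apply/cvgrPdist_lt => eps /harm[N HN]; exists N => // j /= Nj.
  by rewrite distrC (le_lt_trans (wu j x)) ?HN.
have -> : (\int[mu]_(x in `[0%R, 1%R]) (C%:E - lne (cmod (u - cis x))%:E) =
    \int[mu]_(x in `[0%R, 1%R]) limn_einf (f ^~ x))%E.
  by apply: eq_integral => x _; rewrite (cvg_limn_einf_sup (cvgf x)).1.
apply: le_trans (fatou _ _ _ _) _ => //.
- by move=> j; exact: (measurable_funTS (mf j)).
apply: limn_einf_le => j.
have cst_int : mu.-integrable `[0, 1] (EFin \o (cst C : R -> R)).
  by apply: continuous_integrable_itv => x; exact: cst_continuous.
have log_int : mu.-integrable `[0, 1] (EFin \o (fun x => ln (cmod (w j - cis x)))).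
  exact: continuous_integrable_itv.
have f_int : mu.-integrable `[0, 1] (f j).
  rewrite (_ : f j = (EFin \o (cst C : R -> R)) \-
    (EFin \o (fun x => ln (cmod (w j - cis x)))))%E //.
  exact: integrableB.
have := log_mean_ge0 (w1 j).
have -> : (\int[mu]_(x in `[0%R, 1%R]) f j x = (C - log_mean (w j))%:E)%E.
  have -> : C - log_mean (w j) = \int[mu]_(x in `[0, 1]) (C - ln (cmod (w j - cis x))).
    rewrite RintegralB //; congr (_ - _).
    rewrite Rintegral_cst // -[LHS]mulr1; congr (_ * _).
    exact/esym/(congr1 fine lebesgue_measure01).
  by rewrite /Rintegral fineK // integrable_fin_num.
by rewrite lee_fin lerBlDr lerDl.
Qed.

End Circle.

(** * The equilibrium measure of a lemniscate *)

Section Mixture.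
Variable R : realType.

(** The measure is the average of the laws of the [r i] under [P]. *)
Lemma mixture_exists (P : probability (measurableTypeR R) R)
    (r : nat -> R -> CC R) (n : nat) : (0 < n)%N ->
  (forall i, measurable_fun setT (r i : measurableTypeR R -> borelCC R)) ->
  exists mu : probability (borelCC R) R, forall f : borelCC R -> \bar R,
    measurable_fun setT f -> (forall z, (0 <= f z)%E) ->
    (\int[mu]_z f z = n%:R^-1%:E * \sum_(i < n) \int[P]_x f (r i x))%E.
Proof.
move=> n0 mr.
pose X k : {mfun measurableTypeR R >-> borelCC R} :=
  HB.pack (r k : measurableTypeR R -> borelCC R) (isMeasurableFun.Build _ _ _ _ _ (mr k)).
pose m k : {measure set (borelCC R) -> \bar R} := distribution P (X k).
have ninv : 0 <= n%:R^-1 :> R by rewrite invr_ge0 ler0n.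
pose nu : {measure set (borelCC R) -> \bar R} := mscale (NngNum ninv) (msum m n).
have nuE (f : borelCC R -> \bar R) : measurable_fun setT f -> (forall z, (0 <= f z)%E) ->
    (\int[nu]_z f z = n%:R^-1%:E * \sum_(i < n) \int[P]_x f (r i x))%E.
  move=> mf f0; rewrite ge0_integral_mscale // ge0_integral_measure_sum //.
  congr (_ * _)%E; apply: eq_bigr => i _.
  by rewrite ge0_integral_pushforward //; exact: mr.
have nu1 : nu setT = 1%E.
  rewrite /nu /= /mscale /=.
  rewrite (_ : msum m n setT = \sum_(i < n) 1%:E)%E; last first.
    by apply: eq_bigr => i _; exact: (probability_setT (distribution P (X i))).
  rewrite sumEFin sumr_const card_ord -EFinM -mulr_natl mulr1 mulVf //.
  by rewrite pnatr_eq0 -lt0n.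
pose mu : probability (borelCC R) R := HB.pack (mscale (NngNum ninv) (msum m n))
  (Measure_isProbability.Build _ _ _ (mscale (NngNum ninv) (msum m n)) nu1).
by exists mu => f mf f0; exact: nuE.
Qed.

End Mixture.

Section Lemniscate.
Variable R : realType.

(** Stated in the extended reals to cover vanishing factors, for which both sides are [+oo]. *)
Lemma sum_sub_lne (c : R) (n : nat) (d : 'I_n -> R) : (forall i, 0 <= d i) ->
  (\sum_(i < n) (c%:E - lne (d i)%:E) = (n%:R * c)%:E - lne (\prod_(i < n) d i)%:E)%E.
Proof.
elim: n d => [|n IH] d d0; first by rewrite !big_ord0 mul0r lne1 sube0.
rewrite !big_ord_recl IH //.
set D := \prod_(i < n) _; have D0 : 0 <= D by exact: prodr_ge0.
have [->|dn0] := eqVneq (d ord0) 0.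
  rewrite mul0r /= lexx /=; case: ifP => _ /=; first by [].
  by rewrite addye.
have dp : 0 < d ord0 by rewrite lt_def dn0 d0.
have [->|Dn0] := eqVneq D 0.
  by rewrite mulr0 /= lexx /= lt_geF // addey.
have Dp : 0 < D by rewrite lt_def Dn0 D0.
rewrite !lne_EFin ?mulr_gt0 // lnM ?posrE //.
rewrite -!EFinN -!EFinD; congr EFin; rewrite -natr1; ring.
Qed.

Variables (P : {poly CC R}) (n : nat).
Hypotheses (n0 : (0 < n)%N) (Ps : size P = n.+1).
Let a := lead_coef P.

Let a0 : a != 0. Proof. by rewrite lead_coef_eq0 -size_poly_gt0 Ps. Qed.

Lemma fiber_roots : exists r : nat -> R -> CC R,
  (forall i, measurable_fun setT (r i : measurableTypeR R -> borelCC R)) /\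
  forall x z, P.[z] - cis x = a * \prod_(i < n) (z - r i x).
Proof.
pose p (x : measurableTypeR R) := a^-1 *: (P - (cis x)%:P).
have sP x : size (P - (cis x)%:P) = n.+1.
  rewrite size_polyDl // size_polyN Ps.
  by rewrite (leq_ltn_trans (size_polyC_leq1 _)).
have lP x : lead_coef (P - (cis x)%:P) = a.
  rewrite lead_coefDl // size_polyN Ps.
  by rewrite (leq_ltn_trans (size_polyC_leq1 _)).
have [||k|r [rm rE]] := @measurable_roots R _ (measurableTypeR R) n p.
- by move=> x; rewrite monicE lead_coefZ lP mulVf.
- by move=> x; rewrite size_scale ?invr_eq0 // sP.
- have ctrig (f : R -> R) : continuous f ->
      measurable_fun setT (fun x : measurableTypeR R => f (pi *+ 2 * x)).
    move=> cf; apply: continuous_measurable_fun => y.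
    apply: (@continuous_comp _ _ _ (fun y => pi *+ 2 * y) f); last exact: cf.
    exact: mulrl_continuous.
  have ccis : cmeasurable (@cis R : measurableTypeR R -> CC R).
    by split; apply: ctrig; [exact: continuous_cos|exact: continuous_sin].
  rewrite (_ : (fun x => (p x)`_k) = (fun x => a^-1 * (P`_k + (- (k == 0%N)%:R) * cis x))).
    by apply: cmeasurableM; [|apply: cmeasurableD; [|apply: cmeasurableM => //]];
      exact: cmeasurable_cst.
  apply/funext => x; rewrite coefZ coefB coefC; congr (_ * (_ + _)).
  by case: (k == 0%N); rewrite ?mulN1r // oppr0 mul0r.
exists r; split=> [i|x z]; first exact: cmeasurable_measurable.
have := congr1 (fun q => a * q.[z]) (rE x).
rewrite hornerZ mulrA mulfV // mul1r hornerD hornerN hornerC => ->.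
by congr (_ * _); rewrite horner_prod; apply: eq_bigr => i _; rewrite !hornerE.
Qed.

Lemma lemniscate_measure e : measurable (e : set (borelCC R)) -> bounded_set e ->
  [set z : CC R | cmod P.[z] = 1] `<=` e ->
  exists mu : probability (borelCC R) R, mu e = 1%E /\
    (log_energy mu <= (ln (cmod a) / n%:R)%:E)%E.
Proof.
move=> me /bounded_setCC[M HM] Le.
have [r [mr rE]] := fiber_roots.
have [mu muE] := mixture_exists (uniform_prob (@ltr01 R)) n0 mr.
have Pr i x : (i < n)%N -> P.[r i x] = cis x.
  move=> i_n; apply/eqP; rewrite -subr_eq0 rE (bigD1 (Ordinal i_n)) //= subrr.
  by rewrite mul0r mulr0.
have er i x : (i < n)%N -> e (r i x).
  by move=> i_n; apply: Le; rewrite /= Pr // cmod_cis.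
have nR : (0 : R) < n%:R by rewrite ltr0n.
have mue : mu e = 1%E.
  have := muE (EFin \o \1_e) _ _; rewrite integral_indic // setIT => ->.
  - rewrite (eq_bigr (fun=> 1%E)).
      by rewrite sumEFin sumr_const card_ord -EFinM -mulr_natl mulr1 mulVf // gt_eqF.
    move=> i _; rewrite -[RHS](probability_setT (uniform_prob (@ltr01 R))).
    rewrite -[RHS]mul1e -integral_cst //; apply: eq_integral => x _.
    by rewrite /= indicE mem_set //; exact: er.
  - by apply/measurable_EFinP.
  - by move=> z; rewrite lee_fin.
exists mu; split=> //.
pose M' := `|M| + 1.
have ca : 0 < cmod a by rewrite cmod_gt0.
(* The first term dominates the distances in [e]; the second makes [C] below at least [ln 3]. *)
pose c := ln (2 * M') + `|(ln 3 - ln (cmod a)) / n%:R|.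
have M'1 : 1 <= M' by rewrite lerDr.
have c0 : 0 <= c by rewrite addr_ge0 // ln_ge0 //; lra.
have ec z w : e z -> e w -> cmod (z - w) <= expR c.
  move=> /HM zM /HM wM; have := cmodD z (- w); rewrite cmodN => zw.
  rewrite (@le_trans _ _ (2 * M')) //.
    by have := ler_norm M; rewrite /M'; lra.
  by rewrite -[leLHS]lnK ?posrE ?ler_expR ?lerDl //; lra.
rewrite (log_energy_shift me mue c0 ec).
pose C := n%:R * c + ln (cmod a).
have C3 : ln 3 <= C.
  have : (ln 3 - ln (cmod a)) / n%:R <= c.
    by rewrite (le_trans (ler_norm _)) // lerDr ln_ge0 //; lra.
  by rewrite ler_pdivrMr // mulrC lerBlDr.
have msk := @measurable_shift_kernel R c.
(* Summing the kernel over a fibre gives n c + ln |a| - ln |P(z) - s|, and the circle estimate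
   applies at u = P(z). *)
have pot z : cmod P.[z] = 1 -> (potential mu c z <= (n%:R^-1 * C)%:E)%E.
  move=> Pz; have ez : e z by exact: Le.
  rewrite /potential muE; last 2 first.
  - exact: measurable_section.
  - by move=> w; exact: shift_kernel_ge0.
  rewrite EFinM lee_wpmul2l // ?lee_fin ?invr_ge0 ?ler0n //.
  have mri i : measurable_fun setT (fun x : measurableTypeR R => shift_kernel c (z, r i x)).
    by apply: (measurableT_comp (measurable_section _ msk)); exact: mr.
  rewrite (eq_bigr (fun i : 'I_n =>
      \int[@lebesgue_measure R]_(x in `[0%R, 1%R]) shift_kernel c (z, r i x))%E); last first.
    move=> i _; rewrite (integral_uniform (@ltr01 R) (mri i)); last first.
      by move=> x; exact: shift_kernel_ge0.
    by rewrite subr0 invr1 mul1e.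
  rewrite -ge0_integral_sum //; last 2 first.
  - by move=> i; apply: measurable_funTS; exact: mri.
  - by move=> i x _; exact: shift_kernel_ge0.
  apply: le_trans (circle_potential_le Pz C3); rewrite le_eqVlt; apply/orP; left; apply/eqP.
  apply: eq_integral => x _.
  transitivity (\sum_(i < n) (c%:E - lne (cmod (z - r i x))%:E))%E.
    apply: eq_bigr => i _.
    have zr := log_kernel_shift (ec _ _ ez (er i x (ltn_ord i))).
    transitivity (log_kernel (z, r i x) + c%:E)%E; first by rewrite zr subeK.
    by rewrite addeC.
  rewrite sum_sub_lne => [|i]; last exact: cmod_ge0.
  rewrite -cmod_prod; have := congr1 (@cmod R) (rE x z); rewrite cmodM => ->.
  set D := cmod _; have [->|D0] := eqVneq D 0; first by rewrite mulr0 /lne lexx.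
  have Dp : 0 < D by rewrite lt_def D0 cmod_ge0.
  rewrite !lne_EFin ?mulr_gt0 // lnM ?posrE //.
  by rewrite -!EFinN -!EFinD; congr EFin; rewrite /C; ring.
have pot2 : (\int[mu]_z potential mu c z <= (n%:R^-1 * C)%:E)%E.
  rewrite muE; last 2 first.
  - exact: measurable_potential.
  - by move=> z; exact: potential_ge0.
  have U1 i : (i < n)%N ->
      (\int[uniform_prob (@ltr01 R)]_x potential mu c (r i x) <= (n%:R^-1 * C)%:E)%E.
    move=> i_n; rewrite -[leRHS]mule1 -(probability_setT (uniform_prob (@ltr01 R))).
    rewrite -integral_cst //; apply: ge0_le_integral => //.
    - by move=> x _; exact: potential_ge0.
    - by apply: (measurableT_comp (measurable_potential _ _)); exact: mr.
    - by move=> x _; apply: pot; rewrite Pr // cmod_cis.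
  apply: (@le_trans _ _ (n%:R^-1%:E * \sum_(i < n) (n%:R^-1 * C)%:E)%E).
    rewrite lee_wpmul2l // ?lee_fin ?invr_ge0 ?ler0n //.
    by apply: lee_sum => i _; exact: U1.
  rewrite sumEFin sumr_const card_ord -EFinM lee_fin le_eqVlt.
  by apply/orP; left; apply/eqP; field; rewrite pnatr_eq0 -lt0n.
rewrite leeBlDr // (le_trans pot2) // -EFinD lee_fin /C.
by rewrite mulrDr mulKf ?gt_eqF // addrC mulrC.
Qed.

End Lemniscate.

(** * Capacity bounded below by a lemniscate, and the equivalence *)

Section CapacityLower.
Variable R : realType.

Lemma capacity_ge (e : set (CC R)) (P : {poly CC R}) n : compact e ->
  ~ finite_set e -> (0 < n)%N -> size P = n.+1 ->
  [set z | cmod P.[z] = 1] `<=` e ->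
  (cmod (lead_coef P))^-1 <= capacity e ^+ n.
Proof.
move=> ce einf n0 Ps Le.
have a0 : 0 < cmod (lead_coef P).
  by rewrite cmod_gt0 lead_coef_eq0 -size_poly_gt0 Ps.
have me : measurable (e : set (borelCC R)).
  by apply: closed_measurableCC; exact: compact_closedCC.
have be : bounded_set e.
  apply/bounded_setCC; have [M _ HM] := compact_bound 'X ce.
  by exists M => z /HM; rewrite hornerX.
have [mu [mue muE]] := lemniscate_measure n0 Ps me be Le.
set A := cmod (lead_coef P) in a0 muE *.
have H : ((- (ln A / n%:R))%:E <= - min_energy e)%E.
  rewrite EFinN leeN2; apply: le_trans muE; apply: ereal_inf_lbound.
  by exists mu.
have C1 : expR (- (ln A / n%:R)) <= capacity e.
  rewrite -lee_fin fineK ?expeR_min_energy_fin //.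
  by rewrite -[leLHS]/(expeR (- (ln A / n%:R))%:E) lee_expeR.
apply: le_trans (_ : expR (- (ln A / n%:R)) ^+ n <= _).
  by rewrite -expRM_natl mulrN mulrC divfK ?pnatr_eq0 -?lt0n // expRN lnK.
by rewrite lerXn2r ?nnegrE ?capacity_ge0 ?expR_ge0.
Qed.

End CapacityLower.

Theorem theorem1p2 (R : realType) (e : set (CC R)) (n : nat) (T : {poly CC R})
    (e_compact : compact e) (e_infinite : ~ finite_set e) (n_ge1 : (1 <= n)%N)
    (T_chebyshev : is_chebyshev e n T) :
  sup_norm e (horner T) = capacity e ^+ n <->
  exists P : {poly CC R}, size P = n.+1 /\
    outer_boundary e = [set z : CC R | cmod P.[z] = 1].
Proof.
have [Tm Ts Tmin] := T_chebyshev.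
have e0 := infinite_neq0 e_infinite.
have T0 : T != 0 by rewrite monic_neq0.
have t0 := infinite_sup_norm_gt0 e_compact e_infinite T0.
split=> [tC|[P [Ps ob]]].
  set t := sup_norm _ _ in t0 tC.
  have T1 : (1 < size T)%N by rewrite Ts.
  have eT z : e z -> cmod T.[z] <= t by exact: sup_norm_ub.
  have outerE : unbounded_component e = [set z | t < cmod T.[z]].
    rewrite eqEsubset; split; last exact: superlevel_sub_outer.
    move=> z uz /=; rewrite ltNge; apply/negP => Tz.
    have [k [Q [k0 Qm Qs HQ]]] := small_monic Tm Ts n_ge1 t0 e_compact eT uz Tz.
    have kn0 : (0 < k * n)%N by rewrite muln_gt0 k0.
    (* By [tC], the bound at degree [k * n] says that the norm of [Q] is at least [t ^+ k]. *)
    have := capacity_le e_compact e_infinite kn0 Qm Qs.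
    by rewrite mulnC exprM -tC leNgt sup_norm_lt.
  have ti0 : rC t^-1 != 0 by rewrite -cmod_gt0 cmod_rC gtr0_norm ?invr_gt0.
  exists (rC t^-1 *: T); split; first by rewrite size_scale.
  rewrite /outer_boundary outerE superlevel_boundary //.
  rewrite eqEsubset; split=> z /=; rewrite hornerZ cmodM cmod_rC gtr0_norm ?invr_gt0 //.
    by move=> ->; rewrite mulVf // gt_eqF.
  by move=> /(congr1 ( *%R t)); rewrite mulrA mulfV ?gt_eqF // mul1r mulr1.
have P0 : P != 0 by rewrite -size_poly_gt0 Ps.
have a0 : lead_coef P != 0 by rewrite lead_coef_eq0.
have P1 : (1 < size P)%N by rewrite Ps.
have eP := outer_boundary_lemniscate e_compact P1 ob.
apply/eqP; rewrite eq_le capacity_le // andbT.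
apply: (@le_trans _ _ (cmod (lead_coef P))^-1); last first.
  by apply: capacity_ge => //; rewrite -ob; apply: outer_boundary_sub; exact: compact_closedCC.
apply: le_trans (Tmin ((lead_coef P)^-1 *: P) _ _) _.
- by rewrite monicE lead_coefZ mulVf.
- by rewrite size_scale // invr_eq0.
apply: sup_norm_le => // z ez; rewrite hornerZ cmodM cmodV.
by rewrite ler_piMr ?invr_ge0 ?cmod_ge0 ?eP.
Qed.
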